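(* Let $d\in\mathbb{N}$ and $\Omega:=(0,1)^d$. For all grid sizes $h$ and each $p\in\mathbb{N}$, the inequality $$|u_{p,h}|_{H^1(\Omega)}\le 2\,\sqrt{3d}\,h^{-1}\,\|u_{p,h}\|_{L^2(\Omega)}$$ is satisfied for all $u_{p,h}\in\widetilde{W}_{p,h}(\Omega)$.
   Context: $\mathbb{N}=\{1,2,3,\ldots\}$, $\mathbb{N}_0=\mathbb{N}\cup\{0\}$. A grid size (here for the interval $(0,1)$) is a real $h>0$ such that $n_h:=h^{-1}\in\mathbb{N}$. $|u|_{H^1(\Omega)}^2=\sum_{i=1}^d\|\partial u/\partial x_i\|_{L^2(\Omega)}^2$. $\mathbb{P}^p$ is the space of polynomials of degree at most $p$, and $$S_{p,h}(0,1):=\{u\in H^p(0,1): u|_{(hj,h(j+1)]}\in\mathbb{P}^p\text{ for all }j=0,\ldots,n_h-1\}.$$ $\widetilde{S}_{p,h}(0,1)$ is the space of all $u_{p,h}\in S_{p,h}(0,1)$ satisfying $\frac{\partial^{2l+1}}{\partial x^{2l+1}}u_{p,h}(0)=\frac{\partial^{2l+1}}{\partial x^{2l+1}}u_{p,h}(1)=0$ for all $l\in\mathbb{N}_0$ with $2l+1<p$. $\widetilde{W}_{p,h}(\Omega):=\bigotimes_{l=1}^d\widetilde{S}_{p,h}(0,1)$ is the tensor-product space, i.e. the linear span of all functions $(x_1,\ldots,x_d)\mapsto s_1(x_1)\cdots s_d(x_d)$ with $s_1,\ldots,s_d\in\widetilde{S}_{p,h}(0,1)$. *)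

(* Defs.v *)
From HB Require Import structures.
From mathcomp Require Import all_boot all_order all_algebra.
From mathcomp Require Import all_classical all_reals all_analysis.

Set Implicit Arguments.
Unset Strict Implicit.
Unset Printing Implicit Defensive.

Import Order.TTheory GRing.Theory Num.Theory.
Import numFieldNormedType.Exports.

Local Open Scope classical_set_scope.
Local Open Scope ring_scope.

(* Points of R^n are row vectors.  The sigma-algebra on ['rV[R]_n] is the
   product one, generated by the coordinate maps, as for [n.-tuple R]. *)
Section measurable_row.
Context {R : realType} (n : nat).

Let coord (i : 'I_n) (x : 'rV[R]_n) : measurableTypeR R := x ord0 i.

Let row_set0 : g_sigma_preimage coord set0.
Proof. exact: sigma_algebra0. Qed.

Let row_setC A : g_sigma_preimage coord A -> g_sigma_preimage coord (~` A).
Proof. exact: sigma_algebraC. Qed.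

Let row_bigcup (F : _^nat) : (forall i, g_sigma_preimage coord (F i)) ->
  g_sigma_preimage coord (\bigcup_i (F i)).
Proof. exact: sigma_algebra_bigcup. Qed.

#[warning="-redundant-canonical-projection"]
HB.instance Definition _ := @isMeasurable.Build
  (measure_tuple_display default_measure_display)
  'rV[R]_n (g_sigma_preimage coord) row_set0 row_setC row_bigcup.

End measurable_row.

Lemma measurable_coord (R : realType) n (i : 'I_n) :
  measurable_fun setT (fun x : 'rV[R]_n => x ord0 i : measurableTypeR R).
Proof.
move=> _ Y mY; rewrite setTI; apply: sub_sigma_algebra => /=.
rewrite -bigcup_seq/=; exists i => /=; first by rewrite mem_index_enum.
by exists Y => //; rewrite setTI.
Qed.

Lemma measurable_fun_row d (T : measurableType d) (R : realType) n
    (f : T -> 'rV[R]_n) :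
  (forall i, measurable_fun setT (fun t => f t ord0 i : measurableTypeR R)) ->
  measurable_fun setT f.
Proof.
move=> mf _ Y mY; rewrite setTI.
move: Y mY; apply: smallest_sub.
  split => [|A|F].
  - by rewrite /= preimage_set0.
  - by rewrite /= setTD preimage_setC; exact: measurableC.
  - by move=> mF; rewrite /= preimage_bigcup; exact: bigcup_measurable.
move=> A; rewrite -bigcup_seq => -[i _ [B mB <-]] /=.
by rewrite setTI -[X in measurable X]setTI; exact: mf.
Qed.

Definition cons_row (R : realType) n (z : measurableTypeR R * 'rV[R]_n) :
    'rV[R]_n.+1 :=
  \row_i if unlift ord0 i is Some j then z.2 ord0 j else z.1.

Definition behead_row (R : realType) n (x : 'rV[R]_n.+1) :
    measurableTypeR R * 'rV[R]_n :=
  (x ord0 ord0, \row_j x ord0 (lift ord0 j)).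

Lemma measurable_cons_row (R : realType) n :
  measurable_fun setT (@cons_row R n).
Proof.
apply: measurable_fun_row => i.
rewrite (_ : (fun _ => _) = fun z : measurableTypeR R * 'rV[R]_n =>
    if unlift ord0 i is Some j then z.2 ord0 j else z.1); last first.
  by apply/funext => z; rewrite mxE.
case: unliftP => [j _|_]; last exact: measurable_fst.
exact: (measurableT_comp (measurable_coord j) measurable_snd).
Qed.

Lemma measurable_behead_row (R : realType) n :
  measurable_fun setT (@behead_row R n).
Proof.
apply: measurable_fun_pair; first exact: measurable_coord.
apply: measurable_fun_row => i.
rewrite (_ : (fun _ => _) = fun x : 'rV[R]_n.+1 => x ord0 (lift ord0 i)).
  exact: measurable_coord.
by apply/funext => x; rewrite mxE.
Qed.

Lemma cons_rowK (R : realType) n : cancel (@cons_row R n) (@behead_row R n).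
Proof.
move=> [a x]; rewrite /behead_row /cons_row mxE unlift_none /=; congr (_, _).
by apply/rowP => j; rewrite !mxE liftK.
Qed.

Lemma behead_rowK (R : realType) n : cancel (@behead_row R n) (@cons_row R n).
Proof.
move=> x; apply/rowP => i; rewrite mxE.
by case: unliftP => [j ->|->] //=; rewrite mxE.
Qed.

Section lebesgue_row_step.
Local Open Scope ereal_scope.
Context {R : realType} (n : nat).
Variable m : {sigma_finite_measure set 'rV[R]_n -> \bar R}.

Let prod : {measure set (measurableTypeR R * 'rV[R]_n)%type -> \bar R} :=
  (@lebesgue_measure R \x m).

Definition lebesgue_cons : set 'rV[R]_n.+1 -> \bar R :=
  pushforward (@lebesgue_measure R \x m) (@cons_row R n).

Let measurable_pre (A : set 'rV[R]_n.+1) :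
  measurable A -> measurable (@cons_row R n @^-1` A).
Proof.
by move=> mA; rewrite -[X in measurable X]setTI; exact: measurable_cons_row.
Qed.

Let cons0 : lebesgue_cons set0 = 0.
Proof. by rewrite /lebesgue_cons /pushforward preimage_set0; exact: measure0. Qed.

Let cons_ge0 A : 0 <= lebesgue_cons A.
Proof. exact: (measure_ge0 prod). Qed.

Let cons_sigma_additive : semi_sigma_additive lebesgue_cons.
Proof.
move=> F mF tF mUF; rewrite /lebesgue_cons /pushforward preimage_bigcup.
apply: (@measure_semi_sigma_additive _ _ _ prod).
- by move=> k; exact: measurable_pre.
- apply/trivIsetP => /= i j _ _ ij; rewrite -preimage_setI.
  by move/trivIsetP : tF => /(_ _ _ _ _ ij) ->//; rewrite preimage_set0.
- by rewrite -preimage_bigcup; exact: measurable_pre.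
Qed.

HB.instance Definition _ :=
  isMeasure.Build _ _ _ lebesgue_cons cons0 cons_ge0 cons_sigma_additive.

Let cons_sigma_finite : sigma_finite setT lebesgue_cons.
Proof.
have /sigma_finiteP[F [TF ndF Foo]] :=
  sigma_finiteT (@lebesgue_measure R : {sigma_finite_measure set _ -> \bar R}).
have /sigma_finiteP[G [TG ndG Goo]] := sigma_finiteT m.
exists (fun k => @behead_row R n @^-1` (F k `*` G k)).
  rewrite -preimage_bigcup -[LHS](preimage_setT (@behead_row R n)); congr (_ @^-1` _).
  rewrite -setXTT TF TG predeqE => -[x y]; split.
    move=> [/= [i _ Fix] [k _ Gky]]; exists (maxn i k) => //; split.
    - by move: x Fix; exact/subsetPset/ndF/leq_maxl.
    - by move: y Gky; exact/subsetPset/ndG/leq_maxr.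
  by move=> [i _ []/= ? ?]; split; exists i.
move=> k; have [mF Fk] := Foo k; have [mG Gk] := Goo k; split.
  rewrite -[X in measurable X]setTI; apply: measurable_behead_row => //.
  exact: measurableX.
rewrite /lebesgue_cons /pushforward -comp_preimage.
rewrite (_ : _ \o _ = id); last by apply/funext => z /=; rewrite cons_rowK.
by rewrite preimage_id product_measure1E// lte_mul_pinfty// ge0_fin_numE.
Qed.

HB.instance Definition _ :=
  Measure_isSigmaFinite.Build _ _ _ lebesgue_cons cons_sigma_finite.

End lebesgue_row_step.

(* Lebesgue measure on R^n, as the n-fold product of the one on R. *)
Fixpoint lebesgue_row (R : realType) (n : nat) :
    {sigma_finite_measure set 'rV[R]_n -> \bar R} :=
  match n with
  | 0 => \d_(0 : 'rV[R]_0)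
  | n'.+1 => lebesgue_cons (lebesgue_row R n')
  end.

Lemma lebesgue_row_box (R : realType) n (A : 'I_n -> set R) :
  (forall i, measurable (A i : set (measurableTypeR R))) ->
  lebesgue_row R n [set x | forall i, A i (x ord0 i)] =
  (\prod_(i < n) lebesgue_measure (A i))%E.
Proof.
elim: n A => [|n IH] A mA.
  rewrite big_ord0 /= diracE mem_set//; by case.
rewrite big_ord_recl -IH//.
pose B := [set x : 'rV[R]_n | forall i, A (lift ord0 i) (x ord0 i)].
have mB : measurable B.
  rewrite (_ : B = \bigcap_(i in [set: 'I_n])
    ((fun x : 'rV[R]_n => x ord0 i : measurableTypeR R) @^-1` A (lift ord0 i))).
    apply: fin_bigcap_measurable => // i _.
    by rewrite -[X in measurable X]setTI; exact: measurable_coord.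
  by apply/seteqP; split => x /= Hx => [i _|i]; [exact: Hx|exact: (Hx i I)].
have -> : lebesgue_row R n.+1 [set x | forall i, A i (x ord0 i)] =
    (@lebesgue_measure R \x lebesgue_row R n)%E (A ord0 `*` B).
  rewrite /= /lebesgue_cons /pushforward; congr (_ _).
  apply/seteqP; split => -[a x] /=.
    move=> H; split; first by have := H ord0; rewrite mxE unlift_none.
    by move=> i; have := H (lift ord0 i); rewrite mxE liftK.
  by move=> -[Ha Hx] i; rewrite mxE; case: unliftP => [j ->|->] //=.
by rewrite product_measure1E.
Qed.

Section L2.
Context d (T : measurableType d) (R : realType).
Variables (mu : {measure set T -> \bar R}) (D : set T).

(* [u \_ D] is [u] extended by zero outside [D]; the values of [u] outside
   [D] are irrelevant. *)
Definition L2 (u : T -> R) : Prop := (u \_ D : T -> R) \in Lfun mu 2%:E.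

Definition L2norm (u : T -> R) : \bar R := 'N[mu]_2%:E[EFin \o (u \_ D)]%E.

End L2.

Section sobolev_interval.
Context {R : realType}.
Implicit Types u g phi : R -> R.

Definition unit_interval : set R := `]0, 1[.

Definition test_fun phi : Prop :=
  (forall k x, derivable (derive1n k phi) x 1) /\
  exists K : set R,
    [/\ compact K, K `<=` unit_interval & forall x, ~ K x -> phi x = 0].

Definition weak_derivative (k : nat) u g : Prop :=
  forall phi, test_fun phi ->
    \int[@lebesgue_measure R]_(x in unit_interval) (u x * (derive1n k phi) x) =
    (-1) ^+ k * \int[@lebesgue_measure R]_(x in unit_interval) (g x * phi x).

Definition sobolev (p : nat) u : Prop :=
  L2 (@lebesgue_measure R) unit_interval u /\
  forall k, (1 <= k <= p)%N -> exists g,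
    L2 (@lebesgue_measure R) unit_interval g /\ weak_derivative k u g.

End sobolev_interval.

Section sobolev_domain.
Context {R : realType} {d : nat}.
Variable D : set 'rV[R]_d.
Implicit Types u phi : 'rV[R]_d -> R.

Definition partial (i : 'I_d) (f : 'rV[R]_d -> R) : 'rV[R]_d -> R :=
  fun x => 'D_(delta_mx ord0 i) f x.

(* Smooth functions with compact support in [D]: all iterated partial
   derivatives exist and are continuous. *)
Definition test_funn phi : Prop :=
  (forall l : seq 'I_d, let psi := foldr partial phi l in
     continuous psi /\ forall i x, derivable psi x (delta_mx ord0 i)) /\
  exists K : set 'rV[R]_d,
    [/\ compact K, K `<=` D & forall x, ~ K x -> phi x = 0].

Definition weak_partial (i : 'I_d) u (g : 'rV[R]_d -> R) : Prop :=
  forall phi, test_funn phi ->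
    \int[lebesgue_row R d]_(x in D) (u x * partial i phi x) =
    - \int[lebesgue_row R d]_(x in D) (g x * phi x).

(* [g] is the L^2 weak gradient of [u], which is in H^1(D). *)
Definition weak_gradient u (g : 'I_d -> 'rV[R]_d -> R) : Prop :=
  L2 (lebesgue_row R d) D u /\
  forall i, L2 (lebesgue_row R d) D (g i) /\ weak_partial i u (g i).

(* Weak gradients on an open [D] are unique up to null sets, so that the
   infimum is over a single value if [u] is in H^1(D); it is [+oo] if not. *)
Definition H1_seminorm u : \bar R :=
  ereal_inf [set ((\sum_(i < d) L2norm (lebesgue_row R d) D (g i) ^+ 2)
                  `^ 2^-1)%E | g in weak_gradient u].

End sobolev_domain.

Section splines.
Context {R : realType}.

Definition grid_size (h : R) : Prop :=
  0 < h /\ exists n : nat, (0 < n)%N /\ h^-1 = n%:R.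

(* A spline is a function on (0,1]; since [h^-1] is the number of
   subintervals, [j%:R < h^-1] says that j = 0, ..., h^-1 - 1. *)
Definition spline (p : nat) (h : R) (u : R -> R) : Prop :=
  sobolev p u /\
  forall j : nat, j%:R < h^-1 -> exists P : {poly R}, (size P <= p.+1)%N /\
    forall x, h * j%:R < x <= h * j.+1%:R -> u x = P.[x].

(* The derivatives of order < p of a function in H^p(0,1) are continuous up
   to the boundary; their boundary values are one-sided limits. *)
Definition spline_tilde (p : nat) (h : R) (u : R -> R) : Prop :=
  spline p h u /\
  forall l : nat, (2 * l + 1 < p)%N ->
    (derive1n (2 * l + 1) u) x @[x --> 0^'+] --> 0 /\
    (derive1n (2 * l + 1) u) x @[x --> 1^'-] --> 0.

Definition unit_cube (d : nat) : set 'rV[R]_d :=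
  [set x | forall i, 0 < x ord0 i < 1].

Definition W_tilde (d p : nat) (h : R) (u : 'rV[R]_d -> R) : Prop :=
  exists (N : nat) (c : 'I_N -> R) (s : 'I_N -> 'I_d -> R -> R),
    (forall k i, spline_tilde p h (s k i)) /\
    forall x, unit_cube x ->
      u x = \sum_(k < N) c k * \prod_(i < d) s k i (x ord0 i).

End splines.

(* Main.v *)
(* On the line, with |.| the L^2 norm, put A_k = |s^(k)|^2 for a spline s of
   degree p.  For 1 <= k < p integration by parts gives
   A_k = - (s^(k+1), s^(k-1)): s^(k) s^(k-1) is continuous, and it vanishes at
   0 and 1 because one of k, k-1 is odd.  With C = 12 / h^2, expanding
   0 <= |s^(k+1) + C s^(k-1)|^2 yields 2 C A_k <= A_{k+1} + C^2 A_{k-1}, so that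
   A_{k+1} <= C A_k implies A_k <= C A_{k-1}.  The top case A_p <= C A_{p-1} is
   the inverse inequality for affine functions on each cell, and descending to
   k = 1 gives |s'|^2 <= C |s|^2.  The continuity of s^(k) for k < p comes from
   the weak derivatives: testing against a smooth bump shrinking to a knot
   isolates the jump there.  On the cube, the restriction of a tensor-product
   spline to a line parallel to an axis is again such a spline, and Tonelli's
   theorem gives the inequality for each partial derivative. *)

Require Import Defs.
From mathcomp Require Import all_boot all_order all_algebra.
From mathcomp Require Import all_classical all_reals all_analysis.
From mathcomp Require Import measurable_realfun zify ring lra.

Set Implicit Arguments.
Unset Strict Implicit.
Unset Printing Implicit Defensive.

Import Order.TTheory GRing.Theory Num.Theory.
Import numFieldNormedType.Exports.

Local Open Scope classical_set_scope.
Local Open Scope ring_scope.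

(** * Smooth bump functions *)

Section bump.
Context {R : realType}.
Implicit Types (P Q : {poly R}) (x y : R) (f : R -> R).

Lemma cvg_is_derive f x l :
  h^-1 *: (f (h + x) - f x) @[h --> (0 : R)^'] --> l -> is_derive x 1 f l.
Proof.
move=> fl.
have fl' : h^-1 *: ((f \o shift x) (h *: (1 : R)) - f x) @[h --> (0 : R)^'] --> l.
  suff -> : (fun h => h^-1 *: ((f \o shift x) (h *: (1 : R)) - f x)) =
            (fun h => h^-1 *: (f (h + x) - f x)) by [].
  by apply/funext => h /=; rewrite /GRing.scale/= mulr1.
by apply: DeriveDef; [exact: cvgP fl'|exact: cvg_lim fl'].
Qed.

(** For [Q = 1] this is the classical smooth function exp(-1/x), extended by 0 to x <= 0. The
    polynomial factor in 1/x makes the family closed under differentiation. *)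
Definition flat Q x : R := if 0 < x then Q.[x^-1] * expR (- x^-1) else 0.

(** The quotient y^n / n! is one term of the exponential series, whose terms are all nonnegative. *)
Lemma exprn_le_fact_expR y n : 0 <= y -> y ^+ n <= n`!%:R * expR y.
Proof.
move=> y0; case: n => [|n].
  by rewrite expr0 fact0 mul1r (le_trans _ (expR_ge1Dx y))// lerDl.
rewrite -ler_pdivrMl ?ltr0n ?fact_gt0// mulrC (le_trans _ (expR_ge1Dxn n y0))//.
by rewrite lerDr.
Qed.

(** With y = 1/x, each monomial of [Q] contributes at most |q_i| y^i exp(-y) <= |q_i| i!. *)
Lemma flat_bounded Q : exists M : R, 0 <= M /\ forall x, `|flat Q x| <= M.
Proof.
exists (\sum_(i < size Q) `|Q`_i| * i`!%:R); split.
  by apply: sumr_ge0 => i _; rewrite mulr_ge0.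
move=> x; rewrite /flat; case: ifPn => x0; last first.
  by rewrite normr0; apply: sumr_ge0 => i _; rewrite mulr_ge0.
have y0 : 0 <= x^-1 by rewrite invr_ge0 ltW.
rewrite normrM (ger0_norm (expR_ge0 _)) expRN ler_pdivrMr ?expR_gt0//.
rewrite horner_coef (le_trans (ler_norm_sum _ _ _))// mulr_suml ler_sum// => i _.
rewrite normrM -mulrA ler_wpM2l// normrX ger0_norm//.
exact: exprn_le_fact_expR.
Qed.

Lemma flatMX Q x : flat Q x = x * flat ('X * Q) x.
Proof.
rewrite /flat; case: ifPn => [x0|_]; last by rewrite mulr0.
by rewrite hornerM hornerX !mulrA mulfV ?mul1r// gt_eqF.
Qed.

(** For x > 0 the chain rule gives x^(-2) (Q - Q')(1/x) exp(-1/x), again a member of the family. For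
    x < 0 the function is locally 0; at 0 it vanishes to second order. *)
Lemma flat_derive Q x : is_derive x 1 (flat Q) (flat ('X ^+ 2 * (Q - Q^`())) x).
Proof.
have [x0|x0|->] := ltgtP x 0.
- rewrite {2}/flat ltNge ltW//=.
  apply: (near_eq_is_derive (f := cst 0)).
  near=> y; rewrite /flat ltNge; suff -> : y <= 0 by [].
  by apply: ltW; near: y; exact: lt_nbhsl.
- rewrite {2}/flat x0.
  apply: (near_eq_is_derive (f := fun y => Q.[y^-1] * expR (- y^-1))).
    near=> y; rewrite /flat; suff -> : 0 < y by [].
    by near: y; exact: lt_nbhsr.
  have xn0 : x != 0 by rewrite gt_eqF.
  have dV : is_derive x 1 (fun y : R => y^-1) (- x ^- 2).
    have := @is_deriveV R id x 1 1 xn0 _.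
    by move=> /(_ _)/is_derive_eq; apply; rewrite /GRing.scale/= mulr1.
  have dQ : is_derive x 1 (fun y : R => Q.[y^-1]) (Q^`().[x^-1] * - x ^- 2).
    exact: (@is_derive1_comp R (horner Q) (fun y => y^-1)).
  have dN : is_derive x 1 (fun y : R => - y^-1) (x ^- 2).
    by rewrite -[X in is_derive _ _ _ X]opprK; exact: is_deriveN.
  have dE : is_derive x 1 (fun y : R => expR (- y^-1)) (expR (- x^-1) * x ^- 2).
    exact: (@is_derive1_comp R (@expR R) (fun y => - y^-1)).
  have := is_deriveM dQ dE; move/is_derive_eq; apply.
  rewrite !hornerE /GRing.scale/= -exprVn; ring.
- rewrite {2}/flat ltxx; apply: cvg_is_derive.
  (* Pulling out a factor [t] twice turns the difference quotient at 0 into t times a bounded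
     function. The bound [M] may be 0, so the division is by [M + 1]. *)
  have [M [M0 HM]] := flat_bounded ('X * ('X * Q)).
  have M1 : 0 < M + 1 by rewrite ltr_pwDr.
  apply/cvgr0Pnorm_lt => e e0; near=> t.
  have t0 : t != 0 by near: t; exact: nbhs_dnbhs_neq.
  rewrite addr0 {2}/flat ltxx subr0 /GRing.scale/= flatMX mulrA mulVf// mul1r.
  rewrite flatMX normrM (le_lt_trans (ler_wpM2l (normr_ge0 _) (HM t)))//.
  apply: (@le_lt_trans _ _ (`|t| * (M + 1))); first by rewrite ler_wpM2l// lerDl.
  rewrite -ltr_pdivlMr//; near: t.
  exact/dnbhs0_lt/divr_gt0.
Unshelve. all: by end_near.
Qed.

Definition smooth f := forall k x, derivable (derive1n k f) x 1.

(** No higher derivative has to be computed: by induction on [k], every iterated derivative stays in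
    [S], and members of [S] are derivable. *)
Lemma smooth_derivation_closed (S : set (R -> R)) :
  (forall f, S f -> exists2 g, S g & forall x, is_derive x 1 f (g x)) ->
  forall f, S f -> smooth f.
Proof.
move=> Sd f Sf k.
have : S (derive1n k f).
  elim: k => // k /Sd[g Sg dg]; rewrite derive1nS.
  suff -> : derive1 (derive1n k f) = g by [].
  by apply/funext => x; rewrite derive1E; case: (dg x).
by move=> /Sd[g _ dg] x; case: (dg x).
Qed.

Lemma is_derive_affine (a b x : R) : is_derive x 1 (fun y => a * y + b) a.
Proof.
have := is_deriveD (is_deriveM (is_derive_cst a x 1) (is_derive_id x 1))
  (is_derive_cst b x 1).
by move/is_derive_eq; apply; rewrite /GRing.scale/= mulr1 mulr0 !addr0.
Qed.

(** By the product rule, finite sums of such products form a set closed under differentiation. The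
    list [s] encodes such a sum, one pair of polynomials per summand. *)
Lemma flat_prod_smooth (a b c d : R) P Q :
  smooth (fun x => flat P (a * x + b) * flat Q (c * x + d)).
Proof.
pose F (s : seq ({poly R} * {poly R})) (x : R) :=
  \sum_(pq <- s) flat pq.1 (a * x + b) * flat pq.2 (c * x + d).
suff : smooth (F [:: (P, Q)]).
  suff -> : F [:: (P, Q)] =
    (fun x => flat P (a * x + b) * flat Q (c * x + d)) by [].
  by apply/funext => x; rewrite /F big_seq1.
apply: (@smooth_derivation_closed [set F s | s in setT]); last first.
  by exists [:: (P, Q)].
have flatZ k S x : flat (k%:P * S) x = k * flat S x.
  by rewrite /flat; case: ifP => _; rewrite ?mulr0// hornerM hornerC mulrA.
move=> _ [s _ <-]; elim: s => [|[p q] s [g [t _ <-] dg]].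
  exists (F [::]); first by exists [::].
  move=> x; rewrite /F big_nil.
  suff -> : (fun x0 => \sum_(pq <- [::])
    flat pq.1 (a * x0 + b) * flat pq.2 (c * x0 + d)) = cst 0 by exact: is_derive_cst.
  by apply/funext => y; rewrite big_nil.
pose D (u : {poly R}) := 'X ^+ 2 * (u - u^`()).
exists (F [:: (a%:P * D p, q), (p, c%:P * D q) & t]); first by eexists.
move=> x.
have -> : F ((p, q) :: s) =
    (fun x => flat p (a * x + b) * flat q (c * x + d)) \+ F s.
  by apply/funext => y; rewrite /F big_cons.
rewrite {2}/F !big_cons -/(F t x) addrA.
apply: is_deriveD => //=.
have dp : is_derive x 1 (fun x => flat p (a * x + b)) (flat (D p) (a * x + b) * a).
  exact: (@is_derive1_comp R (flat p) (fun y => a * y + b) x _ _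
    (flat_derive _ _) (is_derive_affine _ _ _)).
have dq : is_derive x 1 (fun x => flat q (c * x + d)) (flat (D q) (c * x + d) * c).
  exact: (@is_derive1_comp R (flat q) (fun y => c * y + d) x _ _
    (flat_derive _ _) (is_derive_affine _ _ _)).
have := is_deriveM dp dq; move/is_derive_eq; apply.
by rewrite !flatZ /GRing.scale/=; ring.
Qed.

(** With t = (x - x0)/e this is exp(-1/(1+t)) exp(-1/(1-t)) for |t| < 1 and 0 elsewhere. The
    arguments are expanded as affine functions of [x] to match [flat_prod_smooth]. *)
Definition bump x0 e x := flat 1 (e^-1 * x + (1 - x0 / e)) *
  flat 1 (- e^-1 * x + (1 + x0 / e)).

Lemma bump_smooth x0 e : smooth (bump x0 e).
Proof. exact: flat_prod_smooth. Qed.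

Lemma flat1_ge0_le1 x : 0 <= flat 1 x <= 1.
Proof.
rewrite /flat; case: ifPn => x0; rewrite ?lexx ?ler01//.
by rewrite hornerC mul1r expR_ge0 expR_le1 oppr_le0 invr_ge0 ltW.
Qed.

Lemma bump_ge0_le1 x0 e x : 0 <= bump x0 e x <= 1.
Proof.
have /andP[f0 f1] := flat1_ge0_le1 (e^-1 * x + (1 - x0 / e)).
have /andP[g0 g1] := flat1_ge0_le1 (- e^-1 * x + (1 + x0 / e)).
by rewrite /bump mulr_ge0//= mulr_ile1.
Qed.

(** The height at the centre does not depend on [e], so that a jump tested against the bump keeps
    its size while the support shrinks. *)
Lemma bump_center x0 e : e != 0 -> bump x0 e x0 = expR (-1) ^+ 2.
Proof.
move=> e0; rewrite /bump.
have -> : e^-1 * x0 + (1 - x0 / e) = 1 by field.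
have -> : - e^-1 * x0 + (1 + x0 / e) = 1 by field.
by rewrite /flat ltr01 hornerC invr1 mul1r expr2.
Qed.

Lemma bump_out x0 e x : 0 < e -> e <= `|x - x0| -> bump x0 e x = 0.
Proof.
move=> e0 ex; rewrite /bump /flat.
have -> : e^-1 * x + (1 - x0 / e) = (e + (x - x0)) / e.
  by field; rewrite gt_eqF.
have -> : - e^-1 * x + (1 + x0 / e) = (e - (x - x0)) / e.
  by field; rewrite gt_eqF.
rewrite !pmulr_lgt0 ?invr_gt0//.
have [xx0|xx0] := lerP 0 (x - x0).
- rewrite ger0_norm// in ex.
  have -> : (0 < e - (x - x0)) = false by apply/negbTE; rewrite -leNgt; lra.
  by rewrite mulr0.
- rewrite ltr0_norm// in ex.
  have -> : (0 < e + (x - x0)) = false by apply/negbTE; rewrite -leNgt; lra.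
  by rewrite mul0r.
Qed.

End bump.

(** * Piecewise integration *)

Section cells.
Context {R : realType}.
Notation mu := (@lebesgue_measure R).
Implicit Types (h : R) (f F G : R -> R) (p q : {poly R}).

Lemma integrable_setU d (T : measurableType d)
    (m : {measure set T -> \bar R}) (A B : set T) (f : T -> \bar R) :
  measurable A -> measurable B -> [disjoint A & B] ->
  m.-integrable A f -> m.-integrable B f -> m.-integrable (A `|` B) f.
Proof.
move=> mA mB AB /integrableP[mfA fA] /integrableP[mfB fB].
have mf : measurable_fun (A `|` B) f by apply/measurable_funU.
apply/integrableP; split => //; rewrite ge0_integral_setU//.
- exact: lte_add_pinfty.
- exact: measurableT_comp.
Qed.

Lemma continuous_cc_integrable f (a b : R) : continuous f ->
  mu.-integrable `[a, b] (EFin \o f).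
Proof.
move=> cf; apply: continuous_compact_integrable; first exact: segment_compact.
exact: continuous_subspaceT.
Qed.

Lemma FTC2_Rintegral F f (a b : R) : a < b -> continuous f ->
  (forall x : R, is_derive x 1 F (f x)) ->
  \int[mu]_(x in `[a, b]) f x = F b - F a.
Proof.
move=> ab cf dF.
have cF x : {for x, continuous F}.
  by apply: differentiable_continuous; apply/derivable1_diffP; case: (dF x).
rewrite /Rintegral (@continuous_FTC2 _ f F)//.
- exact: continuous_subspaceT.
- split => [x _||]; first by case: (dF x).
  + exact: cvg_at_right_filter (cF a).
  + exact: cvg_at_left_filter (cF b).
- by move=> x _; rewrite derive1E; case: (dF x).
Qed.

Lemma knot_lt h n : 0 < h -> h * n%:R < h * n.+1%:R.
Proof. by move=> h0; rewrite ltr_pM2l// ltr_nat. Qed.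

Notation cell h j := (`[h * j%:R, h * j.+1%:R]%classic).

(** The half-open cells partition the interval, while the integrals on the right are over closed
    cells, where the fundamental theorem of calculus applies; the added end point is a null set. *)
Lemma piecewise_integral h n G (g : nat -> R -> R) : 0 < h ->
  (forall j, (j < n)%N -> continuous (g j)) ->
  (forall j x, (j < n)%N -> h * j%:R < x <= h * j.+1%:R -> G x = g j x) ->
  mu.-integrable `]0, h * n%:R] (EFin \o G) /\
  \int[mu]_(x in `]0, h * n%:R]) G x =
    \sum_(j < n) \int[mu]_(x in cell h j) g j x.
Proof.
move=> h0; elim: n => [|n IH] cg Gg.
  rewrite mulr0 set_itvoc0 Rintegral_set0 big_ord0; split => //.
  exact: integrable_set0.
have [||iG eG] := IH.
- by move=> j jn; apply: cg; exact: ltnW.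
- by move=> j x jn; apply: Gg; exact: ltnW.
have kn := knot_lt n h0.
have k0 : 0 <= h * n%:R by rewrite mulr_ge0// ltW.
have -> : `]0, h * n.+1%:R]%classic =
    `]0, h * n%:R] `|` `]h * n%:R, h * n.+1%:R].
  by rewrite -itv_bndbnd_setU// bnd_simp// ltW.
have disj : [disjoint `]0, h * n%:R] & `]h * n%:R, h * n.+1%:R]].
  apply/disj_setPS => y [/=]; rewrite 2!in_itv/= => /andP[_ yx] /andP[].
  by rewrite ltNge yx.
have ign : mu.-integrable `]h * n%:R, h * n.+1%:R] (EFin \o g n).
  apply: integrableS (continuous_cc_integrable (h * n%:R) (h * n.+1%:R) (cg n _)) => //.
  exact: subset_itv_oc_cc.
have gG x : x \in `]h * n%:R, h * n.+1%:R] -> g n x = G x.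
  by rewrite in_itv/= => xn; rewrite (Gg n).
have iGn : mu.-integrable `]h * n%:R, h * n.+1%:R] (EFin \o G).
  apply: eq_integrable ign => // x; rewrite inE/= => xn.
  by rewrite gG.
split; first exact: integrable_setU.
rewrite Rintegral_setU//; last exact: integrable_setU.
rewrite big_ord_recr/= eG; congr (_ + _).
rewrite -Rintegral_itv_obnd_cbnd//.
by apply: eq_Rintegral => x; rewrite inE => xn; rewrite gG.
Qed.

(** Half-open cells keep the pieces disjoint: a knot belongs to the cell on its left. The function
    is 0 outside []0, h * n%:R]], hence defined and measurable on the whole line. *)
Definition pp h n (P : nat -> {poly R}) (x : R) : R :=
  \sum_(j < n) \1_(`]h * j%:R, h * j.+1%:R]) x * (P j).[x].

Lemma ppE h n P j x : 0 < h -> (j < n)%N -> h * j%:R < x <= h * j.+1%:R ->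
  pp h n P x = (P j).[x].
Proof.
move=> h0 jn xj; rewrite /pp (bigD1 (Ordinal jn))//= indicE mem_set; last first.
  by rewrite /= in_itv.
rewrite mul1r big1 ?addr0// => i ij; rewrite indicE memNset ?mul0r//=.
rewrite in_itv/= => /andP[ix xi]; move/eqP : ij; apply; apply/val_inj => /=.
move/andP : xj => [jx xj].
apply/eqP; rewrite eqn_leq; apply/andP; split; rewrite -ltnS.
- by rewrite -(ltr_nat R) -(ltr_pM2l h0); exact: lt_le_trans xj.
- by rewrite -(ltr_nat R) -(ltr_pM2l h0); exact: lt_le_trans xi.
Qed.

Lemma cell_exists h n x : 0 < h -> 0 < x <= h * n%:R ->
  exists2 j, (j < n)%N & h * j%:R < x <= h * j.+1%:R.
Proof.
move=> h0; elim: n => [|n IH] /andP[x0 xn].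
  by move: xn; rewrite mulr0 leNgt x0.
have [xn'|nx] := leP x (h * n%:R); last by exists n => //; rewrite nx xn.
by have [|j jn xj] := IH; [rewrite x0 xn'|exists j => //; exact: ltnW].
Qed.

Lemma measurable_pp h n P : measurable_fun setT (pp h n P).
Proof.
apply: measurable_sum => j; apply: measurable_funM.
  exact: measurable_indic.
apply: continuous_measurable_fun; exact: continuous_horner.
Qed.

(** Here [a j] and [b j] stand for the values at the left and right end of cell [j]; regrouping by
    knots leaves the outer boundary values and the jumps. *)
Lemma summation_by_parts n (a b : nat -> R) : (0 < n)%N ->
  \sum_(j < n) (b j - a j) =
  b n.-1 - a 0%N - \sum_(1 <= m < n) (a m - b m.-1).
Proof.
elim: n => // -[|n] IH _.
  by rewrite big_ord_recr big_ord0 /= big_geq// add0r subr0.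
by rewrite big_ord_recr /= IH// [in RHS]big_nat_recr//=; ring.
Qed.

Lemma is_derive_hornerM p (phi dphi : R -> R) (x : R) :
  is_derive x 1 phi (dphi x) ->
  is_derive x 1 (fun y => p.[y] * phi y) (p^`().[x] * phi x + p.[x] * dphi x).
Proof.
move=> dphix; have := is_deriveM (is_derive_poly p x) dphix.
by move/is_derive_eq; apply; rewrite /GRing.scale/=; ring.
Qed.

(* The boundary terms of the cells leave the jumps at the inner knots. *)
Lemma integration_by_parts_cells h n (P : nat -> {poly R}) (phi dphi : R -> R) :
  0 < h -> (0 < n)%N -> continuous dphi ->
  (forall x : R, is_derive x 1 phi (dphi x)) ->
  phi 0 = 0 -> phi (h * n%:R) = 0 ->
  \sum_(j < n) \int[mu]_(x in cell h j) ((P j).[x] * dphi x) =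
  - \sum_(j < n) \int[mu]_(x in cell h j) ((P j)^`().[x] * phi x) -
  \sum_(1 <= m < n) (P m - P m.-1).[h * m%:R] * phi (h * m%:R).
Proof.
move=> h0 n0 cd dphiP p0 p1.
have cphi : continuous phi.
  move=> x; apply: differentiable_continuous; apply/derivable1_diffP.
  by case: (dphiP x).
have c1 p : continuous (fun x => p.[x] * phi x).
  by move=> x; apply: continuousM; [exact: continuous_horner|exact: cphi].
have c2 p : continuous (fun x => p.[x] * dphi x).
  by move=> x; apply: continuousM; [exact: continuous_horner|exact: cd].
have cellE j : \int[mu]_(x in cell h j) ((P j).[x] * dphi x) +
    \int[mu]_(x in cell h j) ((P j)^`().[x] * phi x) =
    (P j).[h * j.+1%:R] * phi (h * j.+1%:R) - (P j).[h * j%:R] * phi (h * j%:R).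
  rewrite addrC -RintegralD//; [|exact: continuous_cc_integrable..].
  apply: (@FTC2_Rintegral (fun x => (P j).[x] * phi x)); first exact: knot_lt.
  - by move=> x; exact: (cvgD (c1 _ x) (c2 _ x)).
  - by move=> x; exact: is_derive_hornerM.
apply/eqP; rewrite eq_sym addrC subr_eq eq_sym -big_split/=; apply/eqP.
under eq_bigr do rewrite cellE.
rewrite (@summation_by_parts n (fun j => (P j).[h * j%:R] * phi (h * j%:R))
  (fun j => (P j).[h * j.+1%:R] * phi (h * j.+1%:R)))// prednK// p1 mulr0.
rewrite mulr0 p0 mulr0 subrr sub0r; congr (- _).
apply: eq_big_nat => m /andP[m0 _].
by rewrite prednK// hornerD hornerN; ring.
Qed.

End cells.

(** * The inverse inequality for univariate splines *)

Section spline_ineq.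
Context {R : realType}.
Notation mu := (@lebesgue_measure R).
Notation cell h j := (`[h * j%:R, h * j.+1%:R]%classic).
Variables (h : R) (n : nat).
Hypotheses (h0 : 0 < h) (n0 : (0 < n)%N).
Implicit Types (p q : {poly R}) (P Q : nat -> {poly R}).

Definition cell_int j p := \int[mu]_(x in cell h j) p.[x].

Let icell j p : mu.-integrable (cell h j) (EFin \o horner p).
Proof. by apply: continuous_cc_integrable; exact: continuous_horner. Qed.

Lemma cell_intD j p q : cell_int j (p + q) = cell_int j p + cell_int j q.
Proof.
rewrite /cell_int -RintegralD//.
by apply: eq_Rintegral => x _; rewrite hornerD.
Qed.

Lemma cell_intZ j (a : R) p : cell_int j (a *: p) = a * cell_int j p.
Proof.
rewrite /cell_int -RintegralZl//.
by apply: eq_Rintegral => x _; rewrite hornerZ.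
Qed.

Lemma cell_int_sqr_ge0 j p : 0 <= cell_int j (p ^+ 2).
Proof. by apply: Rintegral_ge0 => x _; rewrite horner_exp sqr_ge0. Qed.

Lemma cell_int_deriv j p :
  cell_int j p^`() = p.[h * j.+1%:R] - p.[h * j%:R].
Proof.
by apply: FTC2_Rintegral; [exact: knot_lt|exact: continuous_horner].
Qed.

(** Write p = a + b Y with Y the signed distance to the midpoint [m] of the cell. Over the cell Y
    has mean 0 and Y^2 has mean h^2/12, so the integral of p^2 is that of a^2 + (h^2/12) p'^2. *)
Lemma cell_int_linear j p : (size p <= 2)%N ->
  cell_int j (p^`() ^+ 2) <= 12 / h ^+ 2 * cell_int j (p ^+ 2).
Proof.
move=> sp.
have [b [c ->]] : exists b c : R, p = b%:P * 'X + c%:P.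
  exists p`_1, p`_0; rewrite mul_polyC.
  apply/polyP => -[|[|i]]; rewrite coefD coefZ coefX coefC/= ?mulr0 ?mulr1.
  - by rewrite add0r.
  - by rewrite addr0.
  - by rewrite addr0 nth_default// (leq_trans sp).
have -> : (b%:P * 'X + c%:P)^`() = b%:P.
  by rewrite derivD derivM derivX !derivC; ring.
pose m := h * j%:R + h / 2.
pose a := b * m + c.
pose Y : {poly R} := 'X - m%:P.
(* The constants h^2/12 and 1/3 are kept opaque, so that the polynomial identities below contain no
   division. *)
have [k kE] : exists k, k = h ^+ 2 / 12 by eexists.
have [t t3] : exists t : R, t * 3 = 1 by exists 3^-1; field.
(* An antiderivative of 2abY + b^2 (Y^2 - k), the part of p^2 with mean zero; it takes equal values
   at both ends of the cell. *)
pose G := (a * b)%:P * Y ^+ 2 + (b ^+ 2)%:P * (t%:P * Y ^+ 3 - k%:P * Y).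
have dG : G^`() = (a * b)%:P * Y *+ 2 +
    (b ^+ 2)%:P * ((t * 3)%:P * Y ^+ 2 - k%:P).
  rewrite /G !exprS expr0 !mulr1 !(derivD, derivN, derivM, derivX, derivC).
  by rewrite /Y; ring.
rewrite t3 mul1r in dG.
have -> : (b%:P * 'X + c%:P) ^+ 2 = a%:P ^+ 2 + k *: b%:P ^+ 2 + G^`().
  have -> : b%:P * 'X + c%:P = a%:P + b%:P * Y by rewrite /a /Y; ring.
  by rewrite dG -mul_polyC; ring.
have G0 : cell_int j G^`() = 0.
  rewrite cell_int_deriv /G /Y !(hornerD, hornerN, hornerM, horner_exp).
  rewrite !(hornerC, hornerX) kE -natr1 /m.
  have -> : t = 3^-1 by apply: (mulIf (_ : 3 != 0)); rewrite ?t3 ?mulVf.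
  by field.
rewrite !cell_intD G0 addr0 cell_intZ mulrDr mulrA kE.
have -> : 12 / h ^+ 2 * (h ^+ 2 / 12) = 1 by field; rewrite gt_eqF.
rewrite mul1r lerDr mulr_ge0 ?cell_int_sqr_ge0//.
by rewrite divr_ge0 ?sqr_ge0.
Qed.

Lemma summation_cells P : 
  (forall m, (0 < m < n)%N -> (P m).[h * m%:R] = (P m.-1).[h * m%:R]) ->
  \sum_(j < n) cell_int j (P j)^`() = (P n.-1).[h * n%:R] - (P 0%N).[0].
Proof.
move=> cP; under eq_bigr do rewrite cell_int_deriv.
rewrite (@summation_by_parts _ n (fun j => (P j).[h * j%:R])
  (fun j => (P j).[h * j.+1%:R]))// prednK// mulr0.
rewrite big_nat big1 ?subr0// => m /andP[m1 mn].
by rewrite prednK// cP ?m1// subrr.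
Qed.

(** The reduced spline space expressed through its polynomial pieces: H^p regularity has become
    agreement of the derivatives of order below [p] at the inner knots. *)
Definition spline_pieces (p : nat) P :=
  [/\ forall j, (j < n)%N -> (size (P j) <= p.+1)%N,
      forall m k, (0 < m < n)%N -> (k < p)%N ->
        (P m)^`(k).[h * m%:R] = (P m.-1)^`(k).[h * m%:R] &
      forall l, (2 * l + 1 < p)%N ->
        (P 0%N)^`(2 * l + 1).[0] = 0 /\
        (P n.-1)^`(2 * l + 1).[h * n%:R] = 0].

Lemma energy_identity (p : nat) P k : spline_pieces p P -> (k.+1 < p)%N ->
  \sum_(j < n) cell_int j ((P j)^`(k.+1) ^+ 2) =
  - \sum_(j < n) cell_int j ((P j)^`(k.+2) * (P j)^`(k)).
Proof.
move=> [_ cP bP] kp; apply/eqP; rewrite -addr_eq0 -big_split/=.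
pose F j := (P j)^`(k.+1) * (P j)^`(k).
under eq_bigr => j _.
  rewrite -cell_intD addrC.
  have -> : (P j)^`(k.+2) * (P j)^`(k) + (P j)^`(k.+1) ^+ 2 = (F j)^`().
    by rewrite /F derivM -!derivnS expr2.
  over.
rewrite summation_cells => [|m mn]; last first.
  by rewrite !hornerM !cP// ltnW.
rewrite !hornerM.
(* The boundary condition applies to the odd one of the orders [k] and [k.+1], which is
   [2 * k./2 + 1] in both cases, and kills the product at both ends. *)
have [ok|ek] := boolP (odd k).
- have := odd_double_half k; rewrite ok add1n -mul2n => kE.
  have [|b0 b1] := bP k./2; first by rewrite addn1 kE ltnW.
  by rewrite -{2 4}kE -(addn1 (2 * _)) b0 b1 !mulr0 subrr.
- have := odd_double_half k; rewrite (negbTE ek) add0n -mul2n => kE.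
  have [|b0 b1] := bP k./2; first by rewrite addn1 kE.
  by rewrite -{1 3}kE -(addn1 (2 * _)) b0 b1 !mul0r subrr.
Qed.

Lemma size_derivn_le p k : (size p^`(k) <= size p - k)%N.
Proof.
elim: k => [|k IH]; first by rewrite derivn0 subn0.
rewrite derivnS; have [->|/lt_size_deriv] := eqVneq p^`(k) 0; last by lia.
by rewrite deriv0 size_poly0.
Qed.

Lemma spline_inverse_inequality (p : nat) P : (0 < p)%N -> spline_pieces p P ->
  \sum_(j < n) cell_int j ((P j)^`() ^+ 2) <=
  12 / h ^+ 2 * \sum_(j < n) cell_int j (P j ^+ 2).
Proof.
move=> p0 sP; set C := 12 / h ^+ 2.
have C0 : 0 < C by rewrite divr_gt0// exprn_gt0.
pose A k := \sum_(j < n) cell_int j ((P j)^`(k) ^+ 2).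
(* The index [i] counts the steps down from the top order [p]; the goal is the case [i = p.-1]. *)
suff H i : (i < p)%N -> A (p - i)%N <= C * A (p - i).-1.
  have := H p.-1; rewrite prednK// => /(_ (leqnn _)).
  by rewrite (_ : p - p.-1 = 1)%N//; lia.
(* At the top, the derivative of order [p.-1] is affine on each cell. *)
elim: i => [_|i IH ip].
  rewrite subn0 /A mulr_sumr; apply: ler_sum => j _.
  rewrite -{1}(prednK p0) derivnS; apply: cell_int_linear.
  case: sP => /(_ j (ltn_ord j)) sPj _ _.
  by rewrite (leq_trans (size_derivn_le _ _))//; lia.
have {IH} := IH (ltnW ip).
have : (0 < p - i.+1)%N by rewrite subn_gt0.
have : (p - i.+1 < p)%N by rewrite ltn_subrL.
have -> : (p - i = (p - i.+1).+1)%N by lia.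
case: (p - i.+1)%N => // k kp _ /= IH.
have : 0 <= \sum_(j < n) cell_int j (((P j)^`(k.+2) + C *: (P j)^`(k)) ^+ 2).
  by apply: sumr_ge0 => j _; exact: cell_int_sqr_ge0.
have -> : \sum_(j < n) cell_int j (((P j)^`(k.+2) + C *: (P j)^`(k)) ^+ 2) =
    A k.+2 - C *+ 2 * A k.+1 + C ^+ 2 * A k.
  rewrite [A k.+1](energy_identity sP)// mulrN opprK !mulr_sumr -!big_split/=.
  apply: eq_bigr => j _; rewrite -!cell_intZ -!cell_intD; congr cell_int.
  by rewrite -!mul_polyC; ring.
(* The square gives 2C A_(k+1) <= A_(k+2) + C^2 A_k, and the first term on the right is at most C
   A_(k+1) by the induction hypothesis. *)
move=> H; rewrite -(ler_pM2l C0); nra.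
Qed.

End spline_ineq.

(** * Continuity across the knots *)

Section L2_lemmas.
Context d (T : measurableType d) (R : realType).
Variables (mu : {measure set T -> \bar R}) (D : set T).
Hypotheses (mD : measurable D) (Dfin : (mu D < +oo)%E).

(** On a set of finite measure the bound |u| <= 1 + u^2 suffices. *)
Lemma L2_integrable (u : T -> R) : L2 mu D u -> mu.-integrable D (EFin \o u).
Proof.
move=> uL2; have sq := Lfun2_integrable_sqr uL2.
have um : measurable_fun setT (u \_ D) by have := sub_Lfun_mfun uL2; rewrite inE.
apply: (@eq_integrable _ _ _ mu D mD (EFin \o (u \_ D))).
  by move=> x xD; rewrite /= patchE xD.
apply: (@le_integrable _ _ _ mu D mD _ (fun x => (1 + (u \_ D) x ^+ 2)%:E)).
- by apply/measurable_EFinP; exact: measurable_funTS.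
- move=> x _ /=; rewrite lee_fin [leRHS]ger0_norm ?addr_ge0 ?sqr_ge0//.
  rewrite -[(u \_ D) x ^+ 2]real_normK ?num_real//.
  by have := sqr_ge0 (`|(u \_ D) x| - 1); nra.
- apply: (@integrableD _ _ _ mu D mD (cst 1%E) (fun x => ((u \_ D) x ^+ 2)%:E)).
    apply/integrableP; split; first exact: measurable_cst.
    by under eq_integral do rewrite /= normr1; rewrite integral_cst// mul1e.
  exact: integrableS sq.
Qed.

End L2_lemmas.

Section piecewise_splines.
Context {R : realType}.
Notation mu := (@lebesgue_measure R).
Notation cell h j := (`[h * j%:R, h * j.+1%:R]%classic).
Implicit Types (s phi : R -> R) (q : {poly R}).

Lemma derive1n_poly (a b : R) s q : (forall x, a < x < b -> s x = q.[x]) ->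
  forall k x, a < x < b -> derive1n k s x = q^`(k).[x].
Proof.
move=> sq; elim=> [x /sq //|k IH x xab].
move: xab => /andP[ax xb]; rewrite derive1nS derive1E derivnS derivE derive1E.
apply: near_eq_derive; near=> y; apply: IH.
by apply/andP; split;
  [near: y; exact: lt_nbhsr|near: y; exact: lt_nbhsl].
Unshelve. all: by end_near.
Qed.

Lemma smooth_is_derive s : smooth s ->
  forall k (x : R), is_derive x 1 (derive1n k s) (derive1n k.+1 s x).
Proof. by move=> ss k x; rewrite derive1nS derive1E; exact/derivableP/ss. Qed.

Lemma smooth_continuous s k : smooth s -> continuous (derive1n k s).
Proof.
move=> ss x; apply: differentiable_continuous; apply/derivable1_diffP; exact: ss.
Qed.

Lemma unit_interval_measure : mu (@unit_interval R) = 1%E.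
Proof.
by rewrite /unit_interval lebesgue_measure_itv/= lte_fin ltr01 oppr0 adde0.
Qed.

Variables (h : R) (n : nat).
Hypotheses (h0 : 0 < h) (n0 : (0 < n)%N) (hn : h * n%:R = 1).

Lemma integral_unit_interval G (g : nat -> R -> R) :
  (forall j, (j < n)%N -> continuous (g j)) ->
  (forall j x, (j < n)%N -> h * j%:R < x <= h * j.+1%:R -> G x = g j x) ->
  mu.-integrable (@unit_interval R) (EFin \o G) /\
  \int[mu]_(x in (@unit_interval R)) G x =
    \sum_(j < n) \int[mu]_(x in cell h j) g j x.
Proof.
move=> cg Gg; have [] := piecewise_integral h0 cg Gg; rewrite hn => iG <-.
have iG' : mu.-integrable (@unit_interval R) (EFin \o G).
  apply: integrableS iG; [exact: measurable_itv|exact: measurable_itv|move=> x].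
  by rewrite /unit_interval /= !in_itv/= => /andP[-> /ltW].
by split => //; exact: Rintegral_itv_bndo_bndc.
Qed.

(** The strict inequality leaves a neighbourhood of [x] on which the bump coincides with the zero
    polynomial. *)
Lemma derive1n_bump_out (x0 e x : R) k : 0 < e -> e < `|x - x0| ->
  derive1n k (bump x0 e) x = 0.
Proof.
move=> e0 ex; pose r := `|x - x0| - e.
have r0 : 0 < r by rewrite subr_gt0.
rewrite (@derive1n_poly (x - r) (x + r) _ 0).
- by rewrite linear0 horner0.
- move=> y /andP[y1 y2]; rewrite horner0 bump_out//.
  have : `|y - x| <= r by rewrite ler_norml; apply/andP; split; lra.
  have : `|x - x0| <= `|y - x| + `|y - x0|.
    by rewrite (distrC y x); exact: ler_distD.
  by rewrite /r; lra.
- by rewrite ltrBlDr ltrDl r0.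
Qed.

(** Each of the [k] integrations by parts is free of boundary terms, by the vanishing of [phi] and
    its derivatives at 0 and 1, and of jump terms, by the matching of lower orders. The extra order
    [l] carries the induction. *)
Lemma iterated_parts (P : nat -> {poly R}) phi k l : smooth phi ->
  (forall i, derive1n i phi 0 = 0 /\ derive1n i phi 1 = 0) ->
  (forall i m, (i < k)%N -> (0 < m < n)%N ->
    (P m)^`(i).[h * m%:R] = (P m.-1)^`(i).[h * m%:R]) ->
  \sum_(j < n) \int[mu]_(x in cell h j) ((P j).[x] * derive1n (k + l) phi x) =
  (-1) ^+ k *
  \sum_(j < n) \int[mu]_(x in cell h j) ((P j)^`(k).[x] * derive1n l phi x).
Proof.
move=> sphi bphi; elim: k l => [l _|k IH l jump]; first by rewrite expr0 mul1r.
rewrite addSnnS IH; last by move=> i m ik; apply: jump; exact: ltnW.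
have [b0 b1] := bphi l.
rewrite (integration_by_parts_cells (fun j => (P j)^`(k)) h0 n0
  (@smooth_continuous _ l.+1 sphi) (smooth_is_derive sphi l)) ?hn//.
rewrite [X in _ - X]big_nat [X in _ - X]big1 ?subr0 => [|m mn].
  by rewrite exprS mulN1r mulNr mulrN.
by rewrite hornerD hornerN jump// subrr mul0r.
Qed.

(** Inner knots lie in [h, 1 - h], so [e < h] keeps the support of the bump inside (0,1), away from
    both ends. *)
Lemma bump_test m (e : R) : (0 < m < n)%N -> 0 < e < h ->
  test_fun (bump (h * m%:R) e) /\
  forall i, derive1n i (bump (h * m%:R) e) 0 = 0 /\
    derive1n i (bump (h * m%:R) e) 1 = 0.
Proof.
move=> /andP[m0 mn] /andP[e0 eh].
have hm : h <= h * m%:R by rewrite ler_peMr ?ler1n// ltW.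
have hm1 : h * m%:R <= 1 - h.
  have : h * m.+1%:R <= h * n%:R by rewrite ler_pM2l// ler_nat.
  by rewrite hn -natr1 mulrDr mulr1; lra.
split.
  split; first exact: bump_smooth.
  exists `[h * m%:R - e, h * m%:R + e]%classic; split.
  - exact: segment_compact.
  - by move=> x; rewrite /unit_interval /= !in_itv/= => /andP[]; lra.
  - move=> x /= xK; apply: bump_out => //; rewrite leNgt; apply/negP => xe.
    by apply: xK; rewrite in_itv/=; move: xe; rewrite ltr_norml; lra.
move=> i; split; apply: derive1n_bump_out => //.
  by rewrite sub0r normrN ger0_norm; lra.
by rewrite ger0_norm; lra.
Qed.

Lemma integrable_bump (D : set R) F (x0 e : R) : measurable D ->
  mu.-integrable D (EFin \o F) ->
  mu.-integrable D (EFin \o (fun x => F x * bump x0 e x)).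
Proof.
move=> mD iF.
have -> : EFin \o (fun x => F x * bump x0 e x) =
  ((EFin \o F) \* (EFin \o bump x0 e))%E by apply/funext => x /=; rewrite EFinM.
apply: integrableMl => //.
- apply: measurable_funTS; apply: continuous_measurable_fun.
  exact: (@smooth_continuous _ 0 (@bump_smooth R x0 e)).
- exists 1; split; first exact: real1.
  move=> M M1 x _ /=; have /andP[b0 b1] := bump_ge0_le1 x0 e x.
  by rewrite ger0_norm// (le_trans b1)// ltW.
Qed.

Lemma normr_natB_ge1 (i j : nat) : i != j -> 1 <= `|i%:R - j%:R| :> R.
Proof.
wlog ij : i j / (i < j)%N.
  move=> H; rewrite neq_ltn => /orP[ij|ji]; first by rewrite H// neq_ltn ij.
  by rewrite distrC H// neq_ltn ji.
move=> _; rewrite distrC -natrB ?(ltnW ij)// ger0_norm// ler1n subn_gt0//.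
Qed.

(* Otherwise bumps [phi] of fixed height supported in ever smaller
   neighbourhoods of the knot would keep [\int (g - w) * phi] away from 0, [w]
   being the piecewise derivative. *)
Lemma weak_derivative_no_jump s (P : nat -> {poly R}) g k m :
  (forall j x, (j < n)%N -> h * j%:R < x <= h * j.+1%:R -> s x = (P j).[x]) ->
  L2 mu (@unit_interval R) g -> weak_derivative k.+1 s g ->
  (forall i m, (i < k)%N -> (0 < m < n)%N ->
    (P m)^`(i).[h * m%:R] = (P m.-1)^`(i).[h * m%:R]) ->
  (0 < m < n)%N -> (P m)^`(k).[h * m%:R] = (P m.-1)^`(k).[h * m%:R].
Proof.
move=> sP gL2 wg jump mn; pose w := pp h n (fun j => (P j)^`(k.+1)).
pose J := (P m)^`(k).[h * m%:R] - (P m.-1)^`(k).[h * m%:R].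
have mI : measurable (@unit_interval R) by exact: measurable_itv.
have ig : mu.-integrable (@unit_interval R) (EFin \o g).
  apply: L2_integrable gL2 => //.
  by have := unit_interval_measure; rewrite /= => ->; exact: ltry.
have wE j x : (j < n)%N -> h * j%:R < x <= h * j.+1%:R -> w x = (P j)^`(k.+1).[x].
  by move=> jn xj; exact: ppE.
have iw : mu.-integrable (@unit_interval R) (EFin \o w).
  by have [] := integral_unit_interval (fun j _ => continuous_horner (p := _)) wE.
(* The first [k] integrations by parts leave no jumps; one more produces the piecewise derivative
   [w] and the jump of order [k]. Comparison with the weak derivative [g] isolates that jump. *)
have key e : 0 < e < h -> J * expR (-1) ^+ 2 =
    \int[mu]_(x in (@unit_interval R)) ((g x - w x) * bump (h * m%:R) e x).
  move=> eh; have [tphi bphi] := bump_test mn eh.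
  set phi := bump _ _ in tphi bphi *.
  have sphi : smooth phi by exact: bump_smooth.
  have [p0 p1] := bphi 0%N.
  have iM F : mu.-integrable (@unit_interval R) (EFin \o F) ->
      mu.-integrable (@unit_interval R) (EFin \o (fun x => F x * phi x)).
    exact: integrable_bump.
  under eq_Rintegral do rewrite mulrBl.
  rewrite RintegralB//; [|exact: iM..].
  have cphi i : continuous (derive1n i phi) by exact: smooth_continuous.
  have cM i q : continuous (fun x => q.[x] * derive1n i phi x).
    by move=> x; apply: continuousM; [exact: continuous_horner|exact: cphi].
  have wphiE : \int[mu]_(x in (@unit_interval R)) (w x * phi x) =
      \sum_(j < n) \int[mu]_(x in cell h j) ((P j)^`(k.+1).[x] * phi x).
    have [|_ ->//] := integral_unit_interval (G := fun x => w x * phi x)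
      (g := fun j x => (P j)^`(k.+1).[x] * phi x) (fun j _ => cM 0%N _).
    by move=> j x jn xj; rewrite (wE j).
  have sphiE : \int[mu]_(x in (@unit_interval R)) (s x * derive1n k.+1 phi x) =
      \sum_(j < n) \int[mu]_(x in cell h j) ((P j).[x] * derive1n k.+1 phi x).
    have [|_ ->//] := integral_unit_interval
      (G := fun x => s x * derive1n k.+1 phi x)
      (g := fun j x => (P j).[x] * derive1n k.+1 phi x) (fun j _ => cM k.+1 _).
    by move=> j x jn xj; rewrite (sP j).
  have := wg _ tphi; rewrite sphiE -addn1 iterated_parts//.
  rewrite (integration_by_parts_cells (fun j => (P j)^`(k)) h0 n0
    (@smooth_continuous _ 1 sphi) (smooth_is_derive sphi 0)) ?hn//.
  (* Only knot [m] contributes: every other knot is at distance at least [h], hence outside the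
     bump. *)
  rewrite [X in _ - X](_ : _ = J * expR (-1) ^+ 2); last first.
    rewrite (bigD1_seq m) ?iota_uniq ?mem_index_iota//=.
    rewrite {1}/phi bump_center ?gt_eqF//; last by case/andP: eh.
    rewrite hornerD hornerN -/J big1_seq ?addr0// => m' /andP[mm' _].
    rewrite /phi bump_out ?mulr0//; first by case/andP: eh.
    case/andP: eh => e0 eh; rewrite (le_trans (ltW eh))// -mulrBr normrM gtr0_norm//.
    by rewrite ler_peMr ?normr_natB_ge1// ltW.
  rewrite -wphiE addn1 [(-1) ^+ k.+1]exprS mulN1r => /(congr1 (fun y => (-1) ^+ k * y)).
  rewrite mulNr !mulrN !mulrA -!expr2 -exprM mulnC exprM sqrrN expr1n expr1n !mul1r.
  lra.
apply/eqP; rewrite -subr_eq0 -/J; apply/negPn/negP => J0.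
pose f : R -> R := (fun x => g x - w x) \_ (@unit_interval R).
have if_ : mu.-integrable setT (EFin \o f).
  rewrite /f -restrict_EFin; rewrite -integrable_mkcond//.
  have -> : EFin \o (fun x => g x - w x) = ((EFin \o g) \- (EFin \o w))%E by [].
  exact: integrableB.
have eps0 : 0 < `|J * expR (-1) ^+ 2|.
  by rewrite normr_gt0 mulf_neq0// expf_neq0// gt_eqF// expR_gt0.
(* Absolute continuity of the integral: over sets of measure below [r], the integral of |f| is
   smaller than the fixed quantity that [key] produces. *)
have [r [r0 Hr]] := integral_normr_continuous if_ eps0.
(* The support then has length 2e <= 2r/3 < r, and [e < h] as [key] requires. *)
pose e := Num.min (r / 3) (h / 2).
have e0 : 0 < e by rewrite lt_min !divr_gt0.
have er : e <= r / 3 by rewrite ge_min lexx.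
have eh2 : e <= h / 2 by rewrite ge_min lexx orbT.
have eh : 0 < e < h by rewrite e0/=; lra.
pose A := `[h * m%:R - e, h * m%:R + e]%classic.
have : (mu A < r%:E)%E.
  rewrite lebesgue_measure_itv/= lte_fin ifT; last by lra.
  by rewrite -EFinD lte_fin; lra.
move=> /(Hr A (measurable_itv _)); apply/negP; rewrite -leNgt (key e eh).
pose phi := bump (h * m%:R) e.
have -> : \int[mu]_(x in (@unit_interval R)) ((g x - w x) * phi x) =
    \int[mu]_(x in A) (f x * phi x).
  rewrite Rintegral_mkcond [RHS]Rintegral_mkcond; apply: eq_Rintegral => x _.
  rewrite /f !patchE; case: ifPn => xI; case: ifPn => xA //.
  - rewrite /phi bump_out ?mulr0// leNgt; apply/negP => xe.
    move/negP: xA; apply; rewrite inE /A/= in_itv/=.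
    by move: xe; rewrite ltr_norml; lra.
  - by rewrite mul0r.
have iA : mu.-integrable A (EFin \o f).
  by apply: integrableS if_ => //; exact: measurable_itv.
have iAphi : mu.-integrable A (EFin \o (fun x => f x * phi x)).
  by apply: integrable_bump => //; exact: measurable_itv.
rewrite (le_trans (le_normr_Rintegral _ iAphi))//; first exact: measurable_itv.
apply: le_Rintegral => //.
- exact: measurable_itv.
- exact: integrable_norm iAphi.
- exact: integrable_norm iA.
- move=> x _; rewrite normrM ler_piMr//.
  by have /andP[? ?] := bump_ge0_le1 (h * m%:R) e x; rewrite ger0_norm.
Qed.

(** For k < p the weak derivative of order k + 1 is in L^2, which excludes a jump of order k. The
    one-sided limits at 0 and 1 are values of derivatives of the first and the last piece. *)
Lemma spline_tilde_pieces p s : spline_tilde p h s -> exists P,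
  spline_pieces h n p P /\
  forall j x, (j < n)%N -> h * j%:R < x <= h * j.+1%:R -> s x = (P j).[x].
Proof.
move=> [[[_ ws] pieces] bnd].
have hV : h^-1 = n%:R by apply: (mulfI (lt0r_neq0 h0)); rewrite hn mulfV// gt_eqF.
have /choice[P HP] : forall j : nat, exists Q : {poly R}, (j < n)%N ->
    (size Q <= p.+1)%N /\
    forall x, h * j%:R < x <= h * j.+1%:R -> s x = Q.[x].
  (* Beyond the last cell the zero polynomial serves as a default. *)
  move=> j; have [jn|_] := ltnP j n; last by exists 0.
  by have [|Q HQ] := pieces j; [rewrite hV ltr_nat|exists Q].
have sP j x : (j < n)%N -> h * j%:R < x <= h * j.+1%:R -> s x = (P j).[x].
  by move=> jn; exact: (HP j jn).2.
have sP' j x k : (j < n)%N -> h * j%:R < x < h * j.+1%:R ->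
    derive1n k s x = (P j)^`(k).[x].
  move=> jn; apply: derive1n_poly => y /andP[jy yj].
  by apply: sP => //; rewrite jy ltW.
exists P; split => //; split.
- by move=> j jn; exact: (HP j jn).1.
(* Strong induction on the order, over all knots at once: excluding a jump of order [k] needs the
   matching of all lower orders at every inner knot. *)
- move=> m k mn; elim/ltn_ind: k m mn => k IH m mn kp.
  have [|g [gL2 wg]] := ws k.+1; first by [].
  apply: (weak_derivative_no_jump sP gL2 wg) => // i m' ik m'n.
  by apply: IH => //; exact: ltn_trans kp.
- move=> l lp; have [b0 b1] := bnd l lp; split.
  + have c0 : (P 0%N)^`(2 * l + 1).[x] @[x --> 0^'+] --> (P 0%N)^`(2 * l + 1).[0].
      exact/cvg_at_right_filter/continuous_horner.
    apply: (cvg_unique _ c0) => //; apply: cvg_trans b0; apply: near_eq_cvg.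
    near=> x; rewrite (@sP' 0%N)//; rewrite mulr0 mulr1.
    by apply/andP; split; [near: x; exact: nbhs_right_gt|
                           near: x; exact: nbhs_right_lt].
  + rewrite hn.
    have c1 : (P n.-1)^`(2 * l + 1).[x] @[x --> 1^'-] --> (P n.-1)^`(2 * l + 1).[1].
      exact/cvg_at_left_filter/continuous_horner.
    apply: (cvg_unique _ c1) => //; apply: cvg_trans b1; apply: near_eq_cvg.
    have n1 : h * n.-1%:R < h * n%:R by rewrite ltr_pM2l// ltr_nat prednK.
    rewrite hn in n1.
    near=> x; rewrite (@sP' n.-1%N) ?prednK// hn.
    by apply/andP; split; [near: x; exact: nbhs_left_gt|
                           near: x; exact: nbhs_left_lt].
Unshelve. all: by end_near.
Qed.

End piecewise_splines.

(** * Integration along coordinate lines of the cube *)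

Section row_measurability.
Context {R : realType} {n : nat}.
Implicit Types (x : 'rV[R]_n) (i : 'I_n).

Lemma measurable_coordP (B : 'I_n -> set R) :
  (forall i, measurable (B i : set (measurableTypeR R))) ->
  measurable [set x : 'rV[R]_n | forall i, B i (x ord0 i)].
Proof.
move=> mB; rewrite (_ : [set x | _] = \bigcap_(i in [set: 'I_n])
    ((fun x : 'rV[R]_n => x ord0 i : measurableTypeR R) @^-1` B i)).
  apply: fin_bigcap_measurable => // i _.
  by rewrite -[X in measurable X]setTI; exact: measurable_coord.
by apply/seteqP; split => x /= Hx => [i _|i]; [exact: Hx|exact: (Hx i I)].
Qed.

(** The sigma-algebra is the one generated by the coordinates, so [U] is written as the countable
    union of the boxes with rational centre and radius 1/(k+1) that it contains. *)
Lemma open_row_measurable (U : set 'rV[R]_n) : open U -> measurable U.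
Proof.
move=> oU; pose box (q : 'rV[rat]_n * nat) := [set x : 'rV[R]_n |
  forall i, ball (ratr (q.1 ord0 i) : R) q.2.+1%:R^-1 (x ord0 i)].
rewrite (_ : U = \bigcup_(q in [set: 'rV[rat]_n * nat])
    (if `[< box q `<=` U >] then box q else set0)); last first.
  apply/seteqP; split => [x Ux|x [q _]]; last by case: ifPn => // /asboolP; apply.
  have /nbhs_ballP[e /= e0 eU] : nbhs x U by exact: open_nbhs_nbhs.
  (* With 1/(k+1) < e/2, a box of this radius whose centre is that close to [x] contains [x] and
     stays within distance [e] of it. *)
  have [k ke] := ltr_add_invr (divr_gt0 e0 (ltr0n R 2)).
  rewrite add0r in ke.
  have /choice[q Hq] : forall i, exists q : rat, ball (x ord0 i) k.+1%:R^-1 (ratr q : R).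
    move=> i.
    have [|q] := @rat_in_itvoo R (x ord0 i - k.+1%:R^-1) (x ord0 i + k.+1%:R^-1).
      by rewrite ltrD2l gtrN// invr_gt0.
    rewrite in_itv/= => /andP[q1 q2]; exists q.
    by rewrite /ball/= ltr_distlC q1.
  exists (\row_i q i, k) => //.
  have xbox : box (\row_i q i, k) x.
    by move=> i; rewrite /= mxE; apply: ball_sym; exact: Hq.
  case: ifPn => // /asboolP[] y ybox; apply: eU; split => // j i.
  rewrite (ord1 j).
  have : ball (x ord0 i) (k.+1%:R^-1 + k.+1%:R^-1) (y ord0 i).
    apply: ball_triangle (Hq i) _.
    by have := ybox i; rewrite /= mxE.
  by apply: le_ball; rewrite [e]splitr lerD// ltW.
apply: countable_bigcupT_measurable => // q; case: ifP => // _.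
apply: (@measurable_coordP
  (fun i => ball (ratr (q.1 ord0 i) : R) q.2.+1%:R^-1)) => i; rewrite ball_itv; exact: measurable_itv.
Qed.

Lemma continuous_row_measurable (f : 'rV[R]_n -> R) :
  continuous f -> measurable_fun setT f.
Proof.
move=> /continuousP cf; apply: (measurability _ (RGenOpens.measurableE R)).
move=> _ [_ [a [b ->] <-]]; rewrite setTI; apply: open_row_measurable.
exact/cf/interval_open.
Qed.

End row_measurability.

Section slicing.
Context {R : realType}.
Local Notation mu := (@lebesgue_measure R).
Local Notation I01 := (@unit_interval R).
Local Open Scope ereal_scope.

(** For fixed [x] and varying [t] this is the line through [x] in direction [i]. Remaining in the
    same space avoids removing and reinserting a coordinate. *)
Definition set_coord n (i : 'I_n) (x : 'rV[R]_n) (t : R) : 'rV[R]_n :=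
  \row_j if j == i then t else x ord0 j.

Lemma measurable_set_coord n (i : 'I_n) :
  measurable_fun setT
    (fun z : 'rV[R]_n * measurableTypeR R => set_coord i z.1 z.2).
Proof.
apply: measurable_fun_row => j.
rewrite (_ : (fun _ => _) = fun z : 'rV[R]_n * measurableTypeR R =>
    if j == i then z.2 else z.1 ord0 j); last by apply/funext => z; rewrite mxE.
case: (j == i); first exact: measurable_snd.
exact: (measurableT_comp (measurable_coord j) measurable_fst).
Qed.

Lemma unit_cubeE n :
  @unit_cube R n = [set x : 'rV[R]_n | forall i, I01 (x ord0 i)].
Proof.
by apply/seteqP; split => x Hx i; have := Hx i; rewrite /unit_interval/= in_itv.
Qed.

Lemma measurable_unit_cube n : measurable (@unit_cube R n).
Proof.
by rewrite unit_cubeE; apply: (@measurable_coordP R n (fun=> I01)) => i;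
  exact: measurable_itv.
Qed.

Lemma unit_cube_measure n : lebesgue_row R n (@unit_cube R n) = 1.
Proof.
rewrite unit_cubeE (@lebesgue_row_box R n (fun=> I01)) => [|i].
  by rewrite big1// => i _; exact: unit_interval_measure.
exact: measurable_itv.
Qed.

(** Tonelli's theorem on the full product, for [f] extended by zero; for the last claim only the
    second factor is cut off. *)
Lemma fubini_tonelli_setX d1 d2 (T1 : measurableType d1)
    (T2 : measurableType d2) (m1 : {sigma_finite_measure set T1 -> \bar R})
    (m2 : {sigma_finite_measure set T2 -> \bar R})
    (D1 : set T1) (D2 : set T2) (f : T1 * T2 -> \bar R) :
  measurable D1 -> measurable D2 -> measurable_fun setT f ->
  (forall z, 0 <= f z) ->
  [/\ \int[m1 \x m2]_(z in D1 `*` D2) f z =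
        \int[m1]_(x in D1) \int[m2]_(y in D2) f (x, y),
      \int[m1]_(x in D1) \int[m2]_(y in D2) f (x, y) =
        \int[m2]_(y in D2) \int[m1]_(x in D1) f (x, y) &
      measurable_fun setT (fun x => \int[m2]_(y in D2) f (x, y))].
Proof.
move=> mD1 mD2 mf f0; pose g := f \_ (D1 `*` D2).
have mX A : measurable A -> measurable_fun setT (f \_ (A `*` D2)).
  by move=> mA; apply/measurable_restrict;
    [exact: measurableX| |rewrite setTI; exact: measurable_funTS].
have mg := mX _ mD1.
have p0 A z : 0 <= (f \_ A) z by rewrite patchE; case: ifP.
have gF : (fun x => \int[m2]_y g (x, y)) =
    (fun x => \int[m2]_(y in D2) f (x, y)) \_ D1.
  apply/funext => x; rewrite patchE; case: ifPn => xD.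
    rewrite [RHS]integral_mkcond; apply: eq_integral => y _.
    by rewrite /g !patchE in_setX xD.
  rewrite integral0_eq// => y _; rewrite /g patchE in_setX.
  by rewrite (negbTE xD).
have gG : (fun y => \int[m1]_x g (x, y)) =
    (fun y => \int[m1]_(x in D1) f (x, y)) \_ D2.
  apply/funext => y; rewrite patchE; case: ifPn => yD.
    rewrite [RHS]integral_mkcond; apply: eq_integral => x _.
    by rewrite /g !patchE in_setX yD andbT.
  rewrite integral0_eq// => x _; rewrite /g patchE in_setX.
  by rewrite (negbTE yD) andbF.
split.
- rewrite integral_mkcond -/g fubini_tonelli1//; last exact: p0.
  by rewrite [RHS]integral_mkcond -gF.
- rewrite [LHS]integral_mkcond -gF [RHS]integral_mkcond -gG.
  by rewrite fubini_tonelli//; exact: p0.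
- have := measurable_fun_fubini_tonelli_F (m2 := m2) _ (mX _ measurableT) (p0 _).
  rewrite (_ : fubini_F _ _ = fun x => \int[m2]_(y in D2) f (x, y))//.
  apply/funext => x; rewrite [RHS]integral_mkcond; apply: eq_integral => y _.
  by rewrite !patchE in_setX in_setT.
Qed.

Local Notation cube := (@unit_cube R _).

Lemma measurable_slice_integral n (i : 'I_n) (F : 'rV[R]_n -> \bar R) :
  measurable_fun setT F -> (forall x, 0 <= F x) ->
  measurable_fun setT (fun x => \int[mu]_(t in I01) F (set_coord i x t)).
Proof.
move=> mF F0.
have [||||_ _] := @fubini_tonelli_setX _ _ _ _ (lebesgue_row R n) mu setT I01
  (fun z => F (set_coord i z.1 z.2)) => //.
- exact: measurable_itv.
- exact: (measurableT_comp mF (measurable_set_coord i)).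
Qed.

(** The measure in dimension n + 1 is by construction the image of a product measure under
    [cons_row], and the cube pulls back to (0,1) times the smaller cube. *)
Lemma integral_unit_cube_cons n (F : 'rV[R]_n.+1 -> \bar R) :
  measurable_fun setT F -> (forall x, 0 <= F x) ->
  \int[lebesgue_row R n.+1]_(x in cube) F x =
    \int[mu]_(a in I01) \int[lebesgue_row R n]_(y in cube) F (cons_row (a, y)) /\
  \int[mu]_(a in I01) \int[lebesgue_row R n]_(y in cube) F (cons_row (a, y)) =
    \int[lebesgue_row R n]_(y in cube) \int[mu]_(a in I01) F (cons_row (a, y)).
Proof.
move=> mF F0.
have [||||E1 E2 _] := @fubini_tonelli_setX _ _ _ _ mu (lebesgue_row R n) I01
  cube (F \o @cons_row R n) => //.
- exact: measurable_itv.
- exact: measurable_unit_cube.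
- exact: (measurableT_comp mF (@measurable_cons_row R n)).
- by move=> z; exact: F0.
split => //; rewrite -E1.
transitivity (\int[pushforward (mu \x lebesgue_row R n) (@cons_row R n)]_(x in cube) F x).
  by [].
rewrite ge0_integral_pushforward//.
- congr integral; apply/seteqP; split => -[a x] /=.
    move=> H; split; first by have := H ord0; rewrite mxE unlift_none /unit_interval/= in_itv.
    by move=> i; have := H (lift ord0 i); rewrite mxE liftK.
  by move=> -[Ha Hx] i; rewrite mxE; case: unliftP => [j _|_] //=.
- exact: measurable_cons_row.
- exact: measurable_unit_cube.
- exact: measurable_funTS.
Qed.

Lemma set_coord_cons0 n a (y : 'rV[R]_n) t :
  set_coord ord0 (cons_row (a, y)) t = cons_row (t, y).
Proof.
apply/rowP => j; rewrite !mxE; case: unliftP => [k ->|->]; last by rewrite eqxx.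
by have := neq_lift ord0 k; rewrite eq_sym => /negbTE ->.
Qed.

Lemma set_coord_consS n i a (y : 'rV[R]_n) t :
  set_coord (lift ord0 i) (cons_row (a, y)) t = cons_row (a, set_coord i y t).
Proof.
apply/rowP => j; rewrite !mxE/=; case: unliftP => [k ->|->]//=.
by rewrite (inj_eq lift_inj) mxE.
Qed.

(* Integrating out the i-th coordinate first is harmless because (0,1) has
   measure 1. *)
Lemma integral_unit_cube_slice n (i : 'I_n) (F : 'rV[R]_n -> \bar R) :
  measurable_fun setT F -> (forall x, 0 <= F x) ->
  \int[lebesgue_row R n]_(x in cube) F x =
  \int[lebesgue_row R n]_(x in cube)
    \int[mu]_(t in I01) F (set_coord i x t).
Proof.
elim: n i F => [[]//|n IH] i F mF F0.
have [E1 E2] := integral_unit_cube_cons mF F0.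
have S0 x : 0 <= \int[mu]_(t in I01) F (set_coord i x t) by exact: integral_ge0.
have [E3 _] := integral_unit_cube_cons (measurable_slice_integral i mF F0) S0.
rewrite E1 E3; case: (unliftP ord0 i) => [j ->|->].
- apply: eq_integral => a _; rewrite (IH j)//; last first.
    apply: (measurableT_comp mF).
    exact: (measurableT_comp (@measurable_cons_row R n) (measurable_pair1 a)).
  apply: eq_integral => y _; apply: eq_integral => t _.
  by rewrite set_coord_consS.
(* Once the first coordinate is integrated out, the integrand does not depend on [a], and the outer
   integral is over a set of measure 1. *)
- rewrite E2; under [RHS]eq_integral => a _.
    under eq_integral => y _ do under eq_integral => t _ do rewrite set_coord_cons0.
    over.
  rewrite integral_cst; last exact: measurable_itv.
  by rewrite [X in _ * X]unit_interval_measure mule1.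
Qed.

End slicing.

(** * Bounded functions, integrability and the L^2 norm *)

Section bounded_functions.
Context {R : realType} {T : Type}.
Implicit Types f g : T -> R.

(** Together with measurability this gives integrability and membership in L^2 on sets of finite
    measure; unlike integrability, it is stable under products. *)
Definition bounded_fct f := exists M : R, forall x, `|f x| <= M.

Lemma bounded_fctD f g : bounded_fct f -> bounded_fct g ->
  bounded_fct (fun x => f x + g x).
Proof.
move=> [M fM] [N gN]; exists (M + N) => x.
by rewrite (le_trans (ler_normD _ _))// lerD.
Qed.

Lemma bounded_fctM f g : bounded_fct f -> bounded_fct g ->
  bounded_fct (fun x => f x * g x).
Proof.
by move=> [M fM] [N gN]; exists (M * N) => x; rewrite normrM ler_pM.
Qed.

Lemma bounded_fct_cst (a : R) : bounded_fct (fun=> a).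
Proof. by exists `|a|. Qed.

Lemma bounded_fct_sum (I : Type) (r : seq I) (P : pred I) (F : I -> T -> R) :
  (forall i, bounded_fct (F i)) ->
  bounded_fct (fun x => \sum_(i <- r | P i) F i x).
Proof.
move=> bF; elim: r => [|i r [M IH]].
  by exists 0 => x; rewrite big_nil normr0.
have [N FN] := bF i; exists (N + M) => x; rewrite big_cons.
have N0 : 0 <= N by rewrite (le_trans _ (FN x)).
case: ifP => _; last by rewrite (le_trans (IH x))// lerDr.
by rewrite (le_trans (ler_normD _ _))// lerD.
Qed.

Lemma bounded_fct_prod (I : Type) (r : seq I) (P : pred I) (F : I -> T -> R) :
  (forall i, bounded_fct (F i)) ->
  bounded_fct (fun x => \prod_(i <- r | P i) F i x).
Proof.
move=> bF; elim: r => [|i r IH].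
  by exists 1 => x; rewrite big_nil normr1.
have [M MP] : bounded_fct (fun x => if P i then F i x else 1).
  by case: (P i); [exact: bF|exact: bounded_fct_cst].
have [N NP] := bounded_fctM (ex_intro _ M MP) IH.
exists N => x; rewrite big_cons; have := NP x.
by case: (P i); rewrite ?mul1r.
Qed.

End bounded_functions.

Section L2_bounded.
Context d (T : measurableType d) (R : realType).
Variables (mu : {measure set T -> \bar R}) (D : set T).
Hypotheses (mD : measurable D) (Dfin : (mu D < +oo)%E).
Implicit Types f : T -> R.

Lemma bounded_integrable f : measurable_fun D f -> bounded_fct f ->
  mu.-integrable D (EFin \o f).
Proof.
move=> mf [M fM]; apply: measurable_bounded_integrable => //.
exists M; split; first exact: num_real.
by move=> N MN x _ /=; rewrite (le_trans (fM x))// ltW.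
Qed.

Lemma poweR2 (x : \bar R) : (0 <= x -> x `^ 2 = x ^+ 2)%E.
Proof.
case: x => [r|_|//].
  by rewrite lee_fin => r0; rewrite poweR_EFin powR_mulrn// EFin_expe.
by rewrite poweRyr// expeS mulyy.
Qed.

Lemma L2norm_sqr f :
  (L2norm mu D f ^+ 2 = \int[mu]_(x in D) (f x ^+ 2)%:E)%E.
Proof.
rewrite -poweR2 ?Lnorm_ge0// poweR_Lnorm// [RHS]integral_mkcond.
apply: eq_integral => x _; rewrite poweR2//= !patchE -EFinM -expr2.
rewrite real_normK ?num_real//; case: ifP => // _.
by rewrite [X in X ^+ 2](_ : _ = 0)// expr0n.
Qed.

Lemma bounded_L2 f : measurable_fun D f -> bounded_fct f -> L2 mu D f.
Proof.
move=> mf bf.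
have i2 : mu.-integrable D (EFin \o (fun x => f x ^+ 2)).
  apply: bounded_integrable; first exact: measurable_funX.
  by have := bounded_fctM bf bf; under eq_fun do rewrite -expr2.
apply/andP; split; rewrite inE/=.
  by apply/measurable_restrict => //; rewrite setTI.
have := L2norm_sqr f; rewrite -poweR2 ?Lnorm_ge0// => E.
rewrite /finite_norm; apply: (@lty_poweRy _ _ 2) => //.
rewrite -/(L2norm mu D f) E.
case/integrableP: i2 => _; congr (_ < _)%E; apply: eq_integral => x _ /=.
by rewrite ger0_norm// sqr_ge0.
Qed.

End L2_bounded.

(** * Piecewise polynomials on the unit interval *)

Section unit_interval_pieces.
Context {R : realType}.
Notation mu := (@lebesgue_measure R).
Notation cell h j := (`[h * j%:R, h * j.+1%:R]%classic).
Variables (h : R) (n : nat).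
Hypotheses (h0 : 0 < h) (n0 : (0 < n)%N) (hn : h * n%:R = 1).
Implicit Types (P Q : nat -> {poly R}).

(** Cells lie in [0, 1], where powers of x are at most 1, so the absolute values of the coefficients
    sum to a bound. *)
Lemma pp_bounded P : bounded_fct (pp h n P).
Proof.
apply: bounded_fct_sum => j.
exists (\sum_(i < size (P j)) `|(P j)`_i|) => x.
have S0 : 0 <= \sum_(i < size (P j)) `|(P j)`_i| by exact: sumr_ge0.
rewrite indicE; case: (boolP (x \in _)) => [|_]; last by rewrite mul0r normr0.
rewrite inE/= in_itv/= mul1r => /andP[jx xj].
have x0 : 0 <= x by rewrite (le_trans _ (ltW jx))// mulr_ge0// ltW.
have x1 : x <= 1.
  have : h * j.+1%:R <= h * n%:R by rewrite ler_pM2l// ler_nat.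
  by rewrite hn; exact: le_trans.
rewrite horner_coef (le_trans (ler_norm_sum _ _ _))// ler_sum// => i _.
by rewrite normrM ler_piMr// normrX ger0_norm// exprn_ile1.
Qed.

Lemma pp_sum (I : finType) (c : I -> R) (P : I -> nat -> {poly R}) x :
  pp h n (fun j => \sum_k c k *: P k j) x = \sum_k c k * pp h n (P k) x.
Proof.
rewrite /pp; under [RHS]eq_bigr do rewrite mulr_sumr.
rewrite exchange_big/=; apply: eq_bigr => j _.
rewrite horner_sum mulr_sumr; apply: eq_bigr => k _.
by rewrite hornerZ mulrCA.
Qed.

Lemma spline_pieces_sum (p : nat) (I : finType) (c : I -> R)
    (P : I -> nat -> {poly R}) : (forall k, spline_pieces h n p (P k)) ->
  spline_pieces h n p (fun j => \sum_k c k *: P k j).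
Proof.
move=> sP.
have E m k x : (\sum_i c i *: P i m)^`(k).[x] = \sum_i c i * (P i m)^`(k).[x].
  rewrite linear_sum horner_sum; apply: eq_bigr => i _.
  by rewrite linearZ/= hornerZ.
split.
- move=> j jn; rewrite (leq_trans (size_sum _ _ _))//; apply/bigmax_leqP => k _.
  rewrite (leq_trans (size_scale_leq _ _))//; by case: (sP k) => /(_ j jn).
- move=> m k mn kp; rewrite !E; apply: eq_bigr => i _.
  by case: (sP i) => _ -> .
- move=> l lp; rewrite !E; split; apply: big1 => i _;
    case: (sP i) => _ _ /(_ l lp)[b0 b1]; by rewrite ?b0 ?b1 mulr0.
Qed.

Lemma integral_pp_sqr P :
  (\int[mu]_(x in @unit_interval R) (pp h n P x ^+ 2)%:E)%E =
  (\sum_(j < n) cell_int h j (P j ^+ 2))%:E.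
Proof.
have [||iG <-] := integral_unit_interval h0 hn (G := fun x => pp h n P x ^+ 2)
  (g := fun j x => (P j ^+ 2).[x]).
- by move=> j _; exact: continuous_horner.
- by move=> j x jn xj; rewrite (ppE P h0 jn xj) horner_exp.
by rewrite /Rintegral fineK//; apply: integrable_fin_num iG; exact: measurable_itv.
Qed.

Lemma pp_inverse_inequality (p : nat) P : (0 < p)%N -> spline_pieces h n p P ->
  (\int[mu]_(x in @unit_interval R)
     (pp h n (fun j => (P j)^`()) x ^+ 2)%:E <=
   (12 / h ^+ 2)%:E *
   \int[mu]_(x in @unit_interval R) (pp h n P x ^+ 2)%:E)%E.
Proof.
move=> p0 sP; rewrite !integral_pp_sqr -EFinM lee_fin.
exact: (spline_inverse_inequality h0 n0 p0 sP).
Qed.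

(** Since p > 0 the pieces match at the knots and leave no jump terms. The function [psi] is only
    assumed to be C^1; it will be the restriction of a test function on the cube to a line. *)
Lemma pp_parts (p : nat) P (psi dpsi : R -> R) : (0 < p)%N ->
  spline_pieces h n p P -> continuous dpsi ->
  (forall x : R, is_derive x 1 psi (dpsi x)) -> psi 0 = 0 -> psi 1 = 0 ->
  let G x := pp h n P x * dpsi x + pp h n (fun j => (P j)^`()) x * psi x in
  mu.-integrable (@unit_interval R) (EFin \o G) /\
  \int[mu]_(x in @unit_interval R) G x = 0.
Proof.
move=> p0 [_ cP _] cd dpsiP psi0 psi1 G.
have cpsi : continuous psi.
  move=> x; apply: differentiable_continuous; apply/derivable1_diffP.
  by case: (dpsiP x).
have c1 (q : {poly R}) : continuous (fun x : R => q.[x] * psi x).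
  by move=> x; apply: continuousM; [exact: continuous_horner|exact: cpsi].
have c2 (q : {poly R}) : continuous (fun x : R => q.[x] * dpsi x).
  by move=> x; apply: continuousM; [exact: continuous_horner|exact: cd].
have [||iG ->] := integral_unit_interval h0 hn (G := G)
  (g := fun j x => (P j).[x] * dpsi x + (P j)^`().[x] * psi x).
- by move=> j _ x; exact: (cvgD (c2 _ x) (c1 _ x)).
- by move=> j x jn xj; rewrite /G !(ppE _ h0 jn xj).
split => //.
have splitG j : \int[mu]_(x in cell h j) ((P j).[x] * dpsi x + (P j)^`().[x] * psi x) =
    \int[mu]_(x in cell h j) ((P j).[x] * dpsi x) +
    \int[mu]_(x in cell h j) ((P j)^`().[x] * psi x).
  by rewrite RintegralD//; exact: continuous_cc_integrable.
under eq_bigr do rewrite splitG.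
rewrite big_split/= (integration_by_parts_cells P h0 n0 cd dpsiP) ?hn//.
rewrite [X in _ - X + _]big_nat [X in _ - X + _]big1 ?subr0 ?addNr// => m mn.
by rewrite hornerD hornerN (cP m 0%N mn p0) subrr mul0r.
Qed.

End unit_interval_pieces.

(** * Restriction to lines parallel to an axis *)

Section coordinate_lines.
Context {R : realType} {n : nat}.
Implicit Types (x : 'rV[R]_n) (i : 'I_n) (f : 'rV[R]_n -> R).

Lemma set_coordE i x t : set_coord i x t = t *: delta_mx ord0 i + set_coord i x 0.
Proof.
apply/rowP => j; rewrite !mxE eqxx/=.
by case: eqP => _; rewrite ?mulr1 ?addr0// mulr0 add0r.
Qed.

Lemma continuous_set_coord i x : continuous (set_coord i x).
Proof.
rewrite (_ : set_coord i x = fun t => t *: delta_mx ord0 i + set_coord i x 0).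
  move=> t; apply: cvgD; last exact: cvg_cst.
  exact: scalel_continuous.
by apply/funext => t; exact: set_coordE.
Qed.

Lemma set_coord_is_derive i x f (t : R) :
  (forall y, derivable f y (delta_mx ord0 i)) ->
  is_derive t 1 (fun s => f (set_coord i x s)) (partial i f (set_coord i x t)).
Proof.
move=> df; apply: cvg_is_derive.
have := df (set_coord i x t).
rewrite /derivable /partial /derive.
rewrite (_ : (fun h : R => _) = fun h => h^-1 *:
    (f (set_coord i x (h + t)) - f (set_coord i x t))) //.
apply/funext => h /=; congr (_ *: (f _ - _)).
by rewrite [in LHS]set_coordE [in RHS]set_coordE scalerDl addrA.
Qed.

Lemma partial_out f (K : set 'rV[R]_n) i : compact K ->
  (forall x, ~ K x -> f x = 0) -> forall x, ~ K x -> partial i f x = 0.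
Proof.
move=> cK f0 x Kx; rewrite /partial.
have oK : open (~` K).
  by apply: closed_openC; apply: compact_closed => //; exact: norm_hausdorff.
rewrite (@near_eq_derive _ _ _ f (cst 0)) ?derive_cst//.
by near=> y; apply: f0; near: y; exact: open_nbhs_nbhs.
Unshelve. all: by end_near.
Qed.

Lemma compact_support_bounded f (K : set 'rV[R]_n) : compact K ->
  continuous f -> (forall x, ~ K x -> f x = 0) -> bounded_fct f.
Proof.
move=> cK cf f0.
have /compact_bounded[M [_ HM]] : compact (f @` K).
  by apply: continuous_compact => //; exact: continuous_subspaceT.
exists (Num.max 0 (M + 1)) => x; have [Kx|Kx] := pselect (K x).
  rewrite le_max; apply/orP; right; apply: (HM (M + 1)); first by rewrite ltrDl.
  by exists x.
by rewrite f0// normr0 le_max lexx.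
Qed.

End coordinate_lines.

(** * Tensor-product splines *)

Lemma measurable_prod_cond d (T : measurableType d) (R : realType) (I : finType)
    (A : pred I) (D : set T) (F : I -> T -> R) :
  (forall i, measurable_fun D (F i)) ->
  measurable_fun D (fun x => \prod_(i | A i) F i x).
Proof.
move=> mF; under eq_fun do rewrite -big_filter.
by apply: measurable_prod => i _; exact: mF.
Qed.

Section tensor_splines.
Context {R : realType} {d : nat}.
Notation mu := (@lebesgue_measure R).
Notation nu := (lebesgue_row R d).
Notation cube := (@unit_cube R d).
Notation I01 := (@unit_interval R).
Variables (h : R) (n p : nat).
Hypotheses (h0 : 0 < h) (n0 : (0 < n)%N) (hn : h * n%:R = 1) (p0 : (0 < p)%N).
Variables (N : nat) (c : 'I_N -> R) (P : 'I_N -> 'I_d -> nat -> {poly R}).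
Hypothesis sP : forall k i, spline_pieces h n p (P k i).
Implicit Types (x : 'rV[R]_d) (i : 'I_d).

Definition tensor x : R := \sum_k c k * \prod_i pp h n (P k i) (x ord0 i).

(** The partial derivative taken cell by cell: only the factor in the [i]-th variable is
    differentiated. It turns out to be the weak partial derivative. *)
Definition tensor_partial i x : R :=
  \sum_k (c k * \prod_(l | l != i) pp h n (P k l) (x ord0 l)) *
    pp h n (fun j => (P k i j)^`()) (x ord0 i).

(** The pieces of the restriction of [tensor] to the line through [x] in direction [i]: the other
    factors are frozen to scalars. *)
Definition slice_pieces i x (j : nat) : {poly R} :=
  \sum_k (c k * \prod_(l | l != i) pp h n (P k l) (x ord0 l)) *: P k i j.

Lemma slice_pieces_spline i x : spline_pieces h n p (slice_pieces i x).
Proof. by apply: spline_pieces_sum => k; exact: sP. Qed.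

Lemma tensor_slice i x t :
  tensor (set_coord i x t) = pp h n (slice_pieces i x) t.
Proof.
rewrite pp_sum; apply: eq_bigr => k _; rewrite (bigD1 i)//= mulrA mulrAC.
rewrite mxE eqxx; congr (_ * _ * _); apply: eq_bigr => l li.
by rewrite mxE (negbTE li).
Qed.

Lemma tensor_partial_slice i x t : tensor_partial i (set_coord i x t) =
  pp h n (fun j => (slice_pieces i x j)^`()) t.
Proof.
have -> : (fun j => (slice_pieces i x j)^`()) = fun j =>
    \sum_k (c k * \prod_(l | l != i) pp h n (P k l) (x ord0 l)) *: (P k i j)^`().
  apply/funext => j; rewrite /slice_pieces linear_sum; apply: eq_bigr => k _.
  by rewrite linearZ.
rewrite pp_sum; apply: eq_bigr => k _; rewrite mxE eqxx; congr (_ * _ * _).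
by apply: eq_bigr => l li; rewrite mxE (negbTE li).
Qed.

Let measurable_pp_coord Q i :
  measurable_fun setT (fun x : 'rV[R]_d => pp h n Q (x ord0 i)).
Proof. exact: (measurableT_comp (measurable_pp h n Q) (measurable_coord i)). Qed.

Let bounded_pp_coord Q i :
  bounded_fct (fun x : 'rV[R]_d => pp h n Q (x ord0 i)).
Proof. by have [M HM] := pp_bounded h0 hn Q; exists M => x. Qed.

Lemma measurable_tensor : measurable_fun setT tensor.
Proof.
apply: measurable_sum => k; apply: measurable_funM => //.
by apply: measurable_prod_cond => i; exact: measurable_pp_coord.
Qed.

Lemma bounded_tensor : bounded_fct tensor.
Proof.
apply: bounded_fct_sum => k; apply: bounded_fctM; first exact: bounded_fct_cst.
by apply: bounded_fct_prod => i; exact: bounded_pp_coord.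
Qed.

Lemma measurable_tensor_partial i : measurable_fun setT (tensor_partial i).
Proof.
apply: measurable_sum => k; apply: measurable_funM; last exact: measurable_pp_coord.
apply: measurable_funM => //.
by apply: measurable_prod_cond => l; exact: measurable_pp_coord.
Qed.

Lemma bounded_tensor_partial i : bounded_fct (tensor_partial i).
Proof.
apply: bounded_fct_sum => k; apply: bounded_fctM; last exact: bounded_pp_coord.
apply: bounded_fctM; first exact: bounded_fct_cst.
by apply: bounded_fct_prod => l; exact: bounded_pp_coord.
Qed.

Let mcube : measurable cube. Proof. exact: measurable_unit_cube. Qed.

Let cube_fin : (nu cube < +oo)%E.
Proof. by rewrite unit_cube_measure ltry. Qed.

Let I01_fin : (mu I01 < +oo)%E.
Proof. by rewrite unit_interval_measure ltry. Qed.

Let cube_L2 (f : 'rV[R]_d -> R) : measurable_fun setT f -> bounded_fct f ->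
  L2 nu cube f.
Proof. by move=> mf bf; apply: bounded_L2 => //; exact: measurable_funTS. Qed.

(** Both squared norms are first integrated along direction [i]; on each line the univariate inverse
    inequality applies to the slice. *)
Lemma tensor_partial_norm_le i :
  (L2norm nu cube (tensor_partial i) ^+ 2 <=
   (12 / h ^+ 2)%:E * L2norm nu cube tensor ^+ 2)%E.
Proof.
have C0 : 0 <= 12 / h ^+ 2 by rewrite divr_ge0 ?sqr_ge0.
have msqr (f : 'rV[R]_d -> R) : measurable_fun setT f ->
    measurable_fun setT (fun x => (f x ^+ 2)%:E).
  by move=> mf; apply/measurable_EFinP; exact: measurable_funX.
rewrite !L2norm_sqr//.
rewrite (integral_unit_cube_slice i (msqr _ (measurable_tensor_partial i))); last first.
  by move=> x; rewrite lee_fin sqr_ge0.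
rewrite [X in (_ <= _ * X)%E](integral_unit_cube_slice i (msqr _ measurable_tensor)); last first.
  by move=> x; rewrite lee_fin sqr_ge0.
have ms (f : 'rV[R]_d -> R) : measurable_fun setT f -> measurable_fun cube (fun x =>
    \int[mu]_(t in I01) (f (set_coord i x t) ^+ 2)%:E)%E.
  move=> mf; apply: measurable_funTS.
  apply: (measurable_slice_integral i (msqr f mf)) => x.
  by rewrite lee_fin sqr_ge0.
have s0 (f : R -> R) : (0 <= \int[mu]_(t in I01) (f t ^+ 2)%:E)%E.
  by apply: integral_ge0 => t _; rewrite lee_fin sqr_ge0.
rewrite -ge0_integralZl//; last exact: ms measurable_tensor.
apply: ge0_le_integral => //.
- exact: ms (measurable_tensor_partial i).
- apply: measurable_funeM; exact: ms measurable_tensor.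
- move=> x _; under eq_integral do rewrite tensor_partial_slice.
  under [X in (_ <= _ * X)%E]eq_integral do rewrite tensor_slice.
  exact: (pp_inverse_inequality h0 n0 hn p0 (slice_pieces_spline i x)).
Qed.

(* A bounded function that integrates to 0 along every segment in direction
   [i] integrates to 0: add a constant and apply Tonelli's theorem. *)
Lemma integral_cube_slice0 i (H : 'rV[R]_d -> R) :
  measurable_fun setT H -> bounded_fct H ->
  (forall x, mu.-integrable I01 (fun t => (H (set_coord i x t))%:E) /\
    \int[mu]_(t in I01) H (set_coord i x t) = 0) ->
  \int[nu]_(x in cube) H x = 0.
Proof.
move=> mH bH H0; have [M HM] := bH.
have iH : nu.-integrable cube (EFin \o H).
  by apply: bounded_integrable => //; exact: measurable_funTS.
have iM : nu.-integrable cube (EFin \o cst M).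
  by apply: bounded_integrable => //; exact: bounded_fct_cst.
have E : \int[nu]_(x in cube) (H x + M) = M.
  rewrite /Rintegral (integral_unit_cube_slice i); last 2 first.
  - by apply/measurable_EFinP; exact: measurable_funD.
  - by move=> x; rewrite lee_fin; have := HM x; rewrite ler_norml; lra.
  rewrite (eq_integral (cst M%:E)) => [|x _].
    by rewrite integral_cst// [X in (_ * X)%E]unit_cube_measure mule1.
  have [iHx Hx] := H0 x.
  have mI : measurable I01 by exact: measurable_itv.
  have iMx : mu.-integrable I01 (EFin \o cst M).
    by apply: bounded_integrable => //; exact: bounded_fct_cst.
  under eq_integral do rewrite EFinD.
  rewrite integralD//= integral_cst// [X in (_ * X)%E]unit_interval_measure mule1.
  by rewrite -[X in (X + _)%E]fineK ?integrable_fin_num// -/(Rintegral _ _ _) Hx add0e.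
move: E; rewrite RintegralD// Rintegral_cst// [X in fine X]unit_cube_measure mulr1.
by lra.
Qed.

(** The two integrals are merged into one, whose integrand integrates to 0 along every segment in
    direction [i] by the univariate integration by parts. *)
Lemma tensor_weak_partial i : weak_partial cube i tensor (tensor_partial i).
Proof.
move=> phi [sphi [K [cK Ksub K0]]].
have [cphi dphi] := sphi [::]; have [cpart _] := sphi [:: i].
rewrite /= in cphi dphi cpart.
have bphi := compact_support_bounded cK cphi K0.
have bpart := compact_support_bounded cK cpart (partial_out i cK K0).
have mphi := continuous_row_measurable cphi.
have mpart := continuous_row_measurable cpart.
apply/eqP; rewrite -addr_eq0 -RintegralD//; first last.
- apply: bounded_integrable => //.
    by apply: measurable_funTS; apply: measurable_funM => //;
      exact: measurable_tensor_partial.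
  by apply: bounded_fctM => //; exact: bounded_tensor_partial.
- apply: bounded_integrable => //.
    by apply: measurable_funTS; apply: measurable_funM => //;
      exact: measurable_tensor.
  by apply: bounded_fctM => //; exact: bounded_tensor.
apply/eqP; apply: (@integral_cube_slice0 i).
- apply: measurable_funD; apply: measurable_funM => //.
  + exact: measurable_tensor.
  + exact: measurable_tensor_partial.
- apply: bounded_fctD; apply: bounded_fctM => //.
  + exact: bounded_tensor.
  + exact: bounded_tensor_partial.
- move=> x.
  (* A point whose [i]-th coordinate is outside (0,1) is outside the cube, hence outside the
     support, whatever the other coordinates are. *)
  have phi_end t : ~~ (0 < t < 1) -> phi (set_coord i x t) = 0.
    move=> t01; apply: K0 => /Ksub/(_ i); rewrite mxE eqxx => t01'.
    by move/negP: t01.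
  have cslice : continuous (fun t : R => partial i phi (set_coord i x t)).
    by move=> t; apply: continuous_comp; [exact: continuous_set_coord|exact: cpart].
  have dslice (t : R) : is_derive t 1 (fun s => phi (set_coord i x s))
      (partial i phi (set_coord i x t)) by exact: set_coord_is_derive.
  have phi0 : phi (set_coord i x 0) = 0 by apply: phi_end; rewrite ltxx.
  have phi1 : phi (set_coord i x 1) = 0 by apply: phi_end; rewrite ltxx andbF.
  have [iG G0] := pp_parts h0 n0 hn p0 (slice_pieces_spline i x) cslice dslice
    phi0 phi1.
  have E t : tensor (set_coord i x t) * partial i phi (set_coord i x t) +
      tensor_partial i (set_coord i x t) * phi (set_coord i x t) =
      pp h n (slice_pieces i x) t * partial i phi (set_coord i x t) +
      pp h n (fun j => (slice_pieces i x j)^`()) t * phi (set_coord i x t).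
    by rewrite tensor_slice tensor_partial_slice.
  split; first by under eq_fun do rewrite E.
  by under eq_Rintegral do rewrite E.
Qed.

Lemma tensor_H1_le :
  (H1_seminorm cube tensor <=
   (2 * Num.sqrt (3 * d%:R) * h^-1)%:E * L2norm nu cube tensor)%E.
Proof.
have L2t : L2 nu cube tensor.
  by apply: cube_L2; [exact: measurable_tensor|exact: bounded_tensor].
(* The norm is finite, so the remaining estimate takes place in the real numbers. *)
have [a a0 aE] : exists2 a : R, 0 <= a & L2norm nu cube tensor = a%:E.
  have := Lnorm_ge0 nu 2%:E (EFin \o (tensor \_ cube)).
  have : (L2norm nu cube tensor < +oo)%E.
    by have := sub_Lfun_finLfun L2t; rewrite inE.
  rewrite -/(L2norm nu cube tensor); case: (L2norm _ _ _) => // r _ r0.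
  by exists r.
have G : weak_gradient cube tensor tensor_partial.
  split=> // i; split; last exact: tensor_weak_partial.
  by apply: cube_L2;
    [exact: measurable_tensor_partial|exact: bounded_tensor_partial].
(* One weak gradient bounds the infimum from above. *)
apply: le_trans; first by apply: ereal_inf_lbound; exists tensor_partial.
rewrite aE -EFinM.
have S : (\sum_(i < d) L2norm nu cube (tensor_partial i) ^+ 2 <=
    (3 * d%:R * (2 * h^-1 * a) ^+ 2)%:E)%E.
  apply: (@le_trans _ _ (\sum_(i < d) (12 / h ^+ 2 * a ^+ 2)%:E)%E).
    by apply: lee_sum => i _; have := tensor_partial_norm_le i; rewrite aE.
  rewrite sumEFin sumr_const card_ord lee_fin -mulr_natl.
  (* The d directions contribute 12/h^2 each, and 12 d = 3 d 2^2 produces the constant of the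
     theorem. *)
  by rewrite [leLHS](_ : _ = 3 * d%:R * (2 * h^-1 * a) ^+ 2)//; field; rewrite gt_eqF.
rewrite (le_trans (gt0_ler_poweR _ _ _ S))//.
- by rewrite in_itv/= leey andbT; apply: sume_ge0 => i _; exact: sqre_ge0.
- by rewrite in_itv/= leey andbT lee_fin mulr_ge0 ?sqr_ge0.
- have ha : 0 <= 2 * h^-1 * a by rewrite !mulr_ge0// invr_ge0 ltW.
  rewrite poweR_EFin lee_fin powR12_sqrt; last by rewrite mulr_ge0 ?sqr_ge0// mulr_ge0.
  rewrite [X in X <= _]sqrtrM ?mulr_ge0// sqrtr_sqr ger0_norm//.
  by rewrite [leLHS](_ : _ = 2 * Num.sqrt (3 * d%:R) * h^-1 * a)//; ring.
Qed.

End tensor_splines.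

Theorem theorem9 (R : realType) (d : nat) (hd : (0 < d)%N)
    (h : R) (hh : grid_size h) (p : nat) (hp : (0 < p)%N)
    (u : 'rV[R]_d -> R) (hu : W_tilde p h u) :
  (H1_seminorm (@unit_cube R d) u <=
   (2 * Num.sqrt (3 * d%:R) * h^-1)%:E *
     L2norm (lebesgue_row R d) (@unit_cube R d) u)%E.
Proof.
case: hh => h0 [n [n0 hV]]; case: hu => N [c [s [sS uE]]].
have hn : h * n%:R = 1 by rewrite -hV divff// gt_eqF.
have /choice[P HP] : forall ki : 'I_N * 'I_d, exists P,
    spline_pieces h n p P /\
    forall j x, (j < n)%N -> h * j%:R < x <= h * j.+1%:R ->
      s ki.1 ki.2 x = (P j).[x].
  by move=> [k i]; exact: (spline_tilde_pieces h0 n0 hn (sS k i)).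
(* The values of [u] outside the cube are arbitrary; [w] agrees with [u] on the cube and is
   measurable and bounded everywhere. *)
pose w := tensor h n c (fun k i => P (k, i)).
have uw x : unit_cube x -> u x = w x.
  move=> x01; rewrite uE//; apply: eq_bigr => k _; congr (_ * _).
  apply: eq_bigr => i _; have /andP[xi0 xi1] := x01 i.
  have [|j jn xj] := @cell_exists _ h n (x ord0 i) h0; first by rewrite hn xi0 ltW.
  by rewrite (ppE _ h0 jn xj) ((HP (k, i)).2 j).
have rw : u \_ (@unit_cube R d) = w \_ (@unit_cube R d).
  by apply/funext => x; rewrite !patchE; case: ifPn => // /set_mem/uw.
have -> : L2norm (lebesgue_row R d) (@unit_cube R d) u =
    L2norm (lebesgue_row R d) (@unit_cube R d) w by rewrite /L2norm rw.
(* The functions [u] and [w] have the same weak gradients, since all integrals involved are over the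
   cube. *)
have -> : H1_seminorm (@unit_cube R d) u = H1_seminorm (@unit_cube R d) w.
  rewrite /H1_seminorm; congr (ereal_inf (_ @` _)); apply/funext => g.
  rewrite /weak_gradient /weak_partial /L2 rw; apply/propext.
  split=> -[L2w H]; split => // i; have [L2g Hi] := H i; split => // phi tphi;
    rewrite -Hi//; apply: eq_Rintegral => x; rewrite inE => /uw ->//.
by apply: (tensor_H1_le h0 n0 hn hp) => k i; exact: (HP (k, i)).1.
Qed.
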